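(* Let $A$ be a set, let $r$ be a non-trivial cyclically reduced word in the free group $F_A$ on $A$, and let $G=\langle A \mid r=1\rangle$ be the quotient of $F_A$ by the normal closure of $r$. Then: (1) (Freiheitssatz) If $A_0\subset A$ is such that not every letter appearing in $r$ lies in $A_0$, then the subgroup of $G$ generated by (the image of) $A_0$ is a free group with basis $A_0$. (2) If $A$ is finite or countably infinite with a fixed enumeration $a_1,a_2,\dots$, then the word problem in $G$ is decidable: there is an algorithm which, given a word $w$ over $A\cup A^{-1}$, decides whether $w=1$ in $G$.
   Context: A letter $a\in A$ is said to appear in $r$ if $a$ or $a^{-1}$ occurs in the reduced word $r$. A word is cyclically reduced if it is freely reduced and its first letter is not the inverse of its last letter. ''The subgroup generated by $A_0$ is free with basis $A_0$'' means that the natural homomorphism from the free group $F_{A_0}$ to $G$ is injective. *)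

(* Defs.v *)
From HB Require Import structures.
From mathcomp Require Import all_boot.
From mathcomp Require Import boolp classical_sets.

Set Implicit Arguments.
Unset Strict Implicit.
Unset Printing Implicit Defensive.

Local Open Scope classical_set_scope.
Local Open Scope group_scope.

(** The letter [a] is [(a, false)] and its inverse is [(a, true)]. *)
Definition word (A : Type) := seq (A * bool).

Definition letter_inv (A : Type) (x : A * bool) : A * bool := (x.1, ~~ x.2).

(** [reduced] is boolean (through the classical [`[< _ >]]) because it is the
    predicate of a subtype; [A] itself carries no structure. *)
Definition reduced (A : Type) (w : word A) : bool :=
  sorted (fun x y => `[< y <> letter_inv x >]) w.

Definition cyclically_reduced (A : Type) (w : word A) : Prop :=
  reduced w /\ forall x s, w = x :: s -> x <> letter_inv (last x s).

Definition letters (A : Type) (w : word A) : set A :=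
  [set a | exists u b v, w = u ++ (a, b) :: v].

Definition word_val (G : groupType) (A : Type) (gen : A -> G) (w : word A) : G :=
  \prod_(x <- w) (if x.2 then (gen x.1)^-1 else gen x.1).

Section FreeGroup.
Variable A : Type.
Implicit Types (x y : A * bool) (w : word A).

Lemma letter_invK : involutive (@letter_inv A).
Proof. by case=> a b; rewrite /letter_inv /= negbK. Qed.

(** The reduced form of [x :: w], for a reduced word [w]. *)
Definition push x w : word A :=
  if w is y :: w' then if `[< y = letter_inv x >] then w' else x :: w
  else [:: x].

(** The reduced form of [u ++ v], for a reduced word [v]. *)
Definition word_mul (u v : word A) : word A := foldr push v u.

Definition word_inv w : word A := rev (map (@letter_inv A) w).

Lemma reduced_behead x w : reduced (x :: w) -> reduced w.
Proof. exact: path_sorted. Qed.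

Lemma push_reduced x w : reduced w -> reduced (push x w).
Proof.
case: w => [|y w] //= rw; case: asboolP => [_|nxy].
  exact: reduced_behead rw.
by rewrite /reduced /=; apply/andP; split=> //; apply/asboolP.
Qed.

Lemma word_mul_reduced u v : reduced v -> reduced (word_mul u v).
Proof. by move=> rv; elim: u => //= x u; apply: push_reduced. Qed.

Lemma push_cons x w : reduced (x :: w) -> push x w = x :: w.
Proof.
by case: w => [|y w] //= /andP[/asboolP nxy _]; case: asboolP.
Qed.

Lemma pushK x w : reduced w -> push x (push (letter_inv x) w) = w.
Proof.
case: w => [|y w] /= rw; first by rewrite asboolT.
rewrite letter_invK; case: asboolP => [eyx|_] /=; last by rewrite asboolT.
by rewrite push_cons -eyx.
Qed.

Lemma word_mul_push x w z :
  reduced w -> reduced z -> word_mul (push x w) z = push x (word_mul w z).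
Proof.
case: w => [|y w] //= rw rz; case: asboolP => [->|_] //=.
by rewrite pushK // word_mul_reduced.
Qed.

Lemma word_mulA u v w : reduced v -> reduced w ->
  word_mul u (word_mul v w) = word_mul (word_mul u v) w.
Proof.
by move=> rv rw; elim: u => //= x u ->; rewrite word_mul_push ?word_mul_reduced.
Qed.

Lemma word_mul1 w : reduced w -> word_mul w [::] = w.
Proof.
elim: w => //= x w IH rw; rewrite IH ?push_cons //.
exact: reduced_behead rw.
Qed.

Lemma word_inv_reduced w : reduced w -> reduced (word_inv w).
Proof.
rewrite /reduced /word_inv rev_sorted sorted_map.
apply: sub_sorted => x y /asboolP nyx; apply/asboolP.
by rewrite letter_invK => exy; apply: nyx; rewrite exy.
Qed.

Lemma word_invK : involutive word_inv.
Proof. by move=> w; rewrite /word_inv map_rev revK (mapK letter_invK). Qed.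

Lemma word_mulKV u z : reduced z -> word_mul u (word_mul (word_inv u) z) = z.
Proof.
elim: u z => [|x u IH] z rz //=.
have -> : word_inv (x :: u) = rcons (word_inv u) (letter_inv x).
  by rewrite /word_inv /= rev_cons.
rewrite /word_mul foldr_rcons -/(word_mul _ _) -/(word_mul u _).
by rewrite IH ?push_reduced // pushK.
Qed.

Lemma word_mulV w : reduced w -> word_mul w (word_inv w) = [::].
Proof.
move=> rw; rewrite -[RHS](@word_mulKV w [::] isT).
by rewrite word_mul1 // word_inv_reduced.
Qed.

Lemma word_mulVl w : reduced w -> word_mul (word_inv w) w = [::].
Proof.
by move=> rw; rewrite -{2}[w]word_invK word_mulV // word_inv_reduced.
Qed.

Record free_group := FreeGroup { fg_word :> word A; _ : reduced fg_word }.

HB.instance Definition _ := [isSub for fg_word].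
HB.instance Definition _ := gen_eqMixin free_group.
HB.instance Definition _ := gen_choiceMixin free_group.

Lemma fg_reduced (u : free_group) : reduced u.
Proof. exact: valP. Qed.

Definition fg_one : free_group := @FreeGroup [::] isT.
Definition fg_inv (u : free_group) : free_group :=
  FreeGroup (word_inv_reduced (fg_reduced u)).
Definition fg_mul (u v : free_group) : free_group :=
  FreeGroup (word_mul_reduced u (fg_reduced v)).

Lemma fg_mulA : associative fg_mul.
Proof. by move=> u v w; apply: val_inj; rewrite /= word_mulA ?fg_reduced. Qed.
Lemma fg_mul1g : left_id fg_one fg_mul.
Proof. by move=> u; apply: val_inj. Qed.
Lemma fg_mulg1 : right_id fg_one fg_mul.
Proof. by move=> u; apply: val_inj; rewrite /= word_mul1 ?fg_reduced. Qed.
Lemma fg_mulVg : left_inverse fg_one fg_inv fg_mul.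
Proof. by move=> u; apply: val_inj; rewrite /= word_mulVl ?fg_reduced. Qed.
Lemma fg_mulgV : right_inverse fg_one fg_inv fg_mul.
Proof. by move=> u; apply: val_inj; rewrite /= word_mulV ?fg_reduced. Qed.

HB.instance Definition _ := isGroup.Build free_group
  fg_mulA fg_mul1g fg_mulg1 fg_mulVg fg_mulgV.

Definition free_gen (a : A) : free_group := @FreeGroup [:: (a, false)] isT.

Definition free_lift (G : groupType) (gen : A -> G) (u : free_group) : G :=
  word_val gen u.

Section Lift.
Variables (G : groupType) (gen : A -> G).

Lemma word_val_cons x w : word_val gen (x :: w) =
  (if x.2 then (gen x.1)^-1 else gen x.1) * word_val gen w.
Proof. exact: big_cons. Qed.

Lemma word_val_push x w : word_val gen (push x w) = word_val gen (x :: w).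
Proof.
case: w => [|y w] //=; case: asboolP => // ->.
rewrite !word_val_cons mulgA.
by case: x => a [] /=; rewrite ?mulVg ?mulgV mul1g.
Qed.

Lemma free_liftM : {morph free_lift gen : u v / u * v}.
Proof.
move=> u v; rewrite /free_lift /=; elim: (u : word A) => [|x w IH] /=.
  by rewrite [X in _ = X * _]/word_val big_nil mul1g.
by rewrite word_val_push !word_val_cons IH mulgA.
Qed.

Lemma free_lift1 : free_lift gen 1 = 1.
Proof. by rewrite /free_lift /word_val big_nil. Qed.

HB.instance Definition _ := isUMagmaMorphism.Build free_group G (free_lift gen)
  (free_lift1, free_liftM).

Lemma free_lift_gen a : free_lift gen (free_gen a) = gen a.
Proof. by rewrite /free_lift /word_val big_seq1. Qed.

End Lift.

End FreeGroup.

Definition normal_subgroup (G : groupType) (N : set G) : Prop :=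
  [/\ N 1, forall x y, N x -> N y -> N (x / y) & forall x y, N x -> N (x ^ y)].

Definition normal_closure (G : groupType) (S : set G) : set G :=
  [set x | forall N : set G, normal_subgroup N -> S `<=` N -> N x].

Section Quotient.
Variables (G : groupType) (S : set G).

Lemma normal_closure_normal : normal_subgroup (normal_closure S).
Proof.
split=> [N [] //|x y Nx Ny N nN SN|x y Nx N nN SN].
- by case: (nN) => _ H _; apply: H; [apply: Nx|apply: Ny].
- by case: (nN) => _ _ H; apply: H; apply: Nx.
Qed.

Definition ncl_rel : rel G := fun x y => `[< normal_closure S (x / y) >].

Lemma ncl_rel_refl : reflexive ncl_rel.
Proof.
by move=> x; apply/asboolP; rewrite mulgV; case: normal_closure_normal.
Qed.

Lemma ncl_rel_sym : symmetric ncl_rel.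
Proof.
case: normal_closure_normal => N1 NF _ x y; apply/asboolP/asboolP => H.
- by rewrite -invgF -[_^-1]mul1g; apply: NF.
- by rewrite -invgF -[_^-1]mul1g; apply: NF.
Qed.

Lemma ncl_rel_trans : transitive ncl_rel.
Proof.
case: normal_closure_normal => _ NF _ y x z /asboolP xy; rewrite ncl_rel_sym.
move=> /asboolP zy; apply/asboolP.
by have := NF _ _ xy zy; rewrite invgF mulgA mulgVK.
Qed.

Canonical ncl_equiv := EquivRel ncl_rel ncl_rel_refl ncl_rel_sym ncl_rel_trans.

Definition quotient_group := {eq_quot ncl_equiv}%qT.
HB.instance Definition _ := Choice.on quotient_group.
HB.instance Definition _ := EqQuotient.on quotient_group.

Definition quot_map (x : G) : quotient_group := \pi_quotient_group%qT x.

Lemma quot_mapP x y :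
  quot_map x = quot_map y <-> normal_closure S (x / y).
Proof. by split=> [/eqmodP/asboolP|H]; last exact/eqmodP/asboolP. Qed.

Definition quot_one : quotient_group := quot_map 1.
Definition quot_inv (a : quotient_group) : quotient_group :=
  quot_map (repr a)^-1.
Definition quot_mul (a b : quotient_group) : quotient_group :=
  quot_map (repr a * repr b).

Lemma quot_repr (a : quotient_group) : quot_map (repr a) = a.
Proof. exact: reprK. Qed.

Lemma quot_mulE x y : quot_mul (quot_map x) (quot_map y) = quot_map (x * y).
Proof.
apply/quot_mapP; have [N1 NF NJ] := normal_closure_normal.
have /quot_mapP Nx := quot_repr (quot_map x).
have /quot_mapP Ny := quot_repr (quot_map y).
set x' := repr _ in Nx *; set y' := repr _ in Ny *.
have -> : x' * y' / (x * y) = (x' / x) / ((y / y') ^ x^-1).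
  by rewrite conjgE invgK !invgM !invgK !mulgA mulgVK.
apply: (NF) => //; apply: NJ.
by rewrite -invgF -[_^-1]mul1g; apply: (NF).
Qed.

Lemma quot_invE x : quot_inv (quot_map x) = quot_map x^-1.
Proof.
apply/quot_mapP; have [N1 NF NJ] := normal_closure_normal.
have /quot_mapP Nx := quot_repr (quot_map x).
set x' := repr _ in Nx *.
have -> : x'^-1 / x^-1 = (1 / (x' / x)) ^ x.
  by rewrite conjgE mul1g invgF mulgA mulKg invgK.
by apply: NJ; apply: NF.
Qed.

Lemma quot_mulA : associative quot_mul.
Proof.
move=> a b c; rewrite -(quot_repr a) -(quot_repr b) -(quot_repr c).
by rewrite !quot_mulE mulgA.
Qed.
Lemma quot_mul1g : left_id quot_one quot_mul.
Proof. by move=> a; rewrite -(quot_repr a) quot_mulE mul1g. Qed.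
Lemma quot_mulg1 : right_id quot_one quot_mul.
Proof. by move=> a; rewrite -(quot_repr a) quot_mulE mulg1. Qed.
Lemma quot_mulVg : left_inverse quot_one quot_inv quot_mul.
Proof. by move=> a; rewrite -(quot_repr a) quot_invE quot_mulE mulVg. Qed.
Lemma quot_mulgV : right_inverse quot_one quot_inv quot_mul.
Proof. by move=> a; rewrite -(quot_repr a) quot_invE quot_mulE mulgV. Qed.

HB.instance Definition _ := isGroup.Build quotient_group
  quot_mulA quot_mul1g quot_mulg1 quot_mulVg quot_mulgV.

Lemma quot_mapM : {morph quot_map : x y / x * y}.
Proof. by move=> x y; rewrite -quot_mulE. Qed.

HB.instance Definition _ := isUMagmaMorphism.Build G quotient_group quot_map
  (erefl, quot_mapM).

End Quotient.

Definition one_relator_group (A : Type) (r : free_group A) : groupType :=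
  quotient_group [set r].

Definition one_relator_gen (A : Type) (r : free_group A) (a : A) :
    one_relator_group r :=
  quot_map [set r] (free_gen a).

(** The total recursive functions of several variables; the minimization
    operator is restricted to the functions that have a zero for all values of
    the parameters, so that no partial function is involved. *)
Inductive recursive : forall n, (n.-tuple nat -> nat) -> Prop :=
| recursive_zero n :
    recursive (fun _ : n.-tuple nat => 0%N)
| recursive_succ :
    recursive (fun v : 1.-tuple nat => (thead v).+1)
| recursive_proj n (i : 'I_n) :
    recursive (fun v : n.-tuple nat => tnth v i)
| recursive_comp m n (f : m.-tuple nat -> nat)
      (g : 'I_m -> n.-tuple nat -> nat) :
    recursive f -> (forall i, recursive (g i)) ->
    recursive (fun v : n.-tuple nat => f [tuple g i v | i < m])
| recursive_prim n (f : n.-tuple nat -> nat) (g : n.+2.-tuple nat -> nat) :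
    recursive f -> recursive g ->
    recursive (fun v : n.+1.-tuple nat =>
      iteri (thead v) (fun k y => g [tuple of k :: y :: behead_tuple v])
        (f (behead_tuple v)))
| recursive_min n (f : n.+1.-tuple nat -> nat) (g : n.-tuple nat -> nat) :
    recursive f ->
    (forall v : n.-tuple nat, f [tuple of g v :: v] = 0%N /\
      forall y, (y < g v)%N -> f [tuple of y :: v] <> 0%N) ->
    recursive g.

(** The Goedel number of a word over letters numbered by [num]: the letter
    [num a = i] has code [2 i], its inverse has code [2 i + 1], and
    [CodeSeq.code] is a bijection from the finite sequences of natural numbers
    to the natural numbers. *)
Definition word_code (I : Type) (num : I -> nat) (w : word I) : nat :=
  CodeSeq.code [seq ((num x.1).*2 + nat_of_bool x.2)%N | x <- w].

(** The word problem for the generators [gen i] of [G]: the recursive function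
    [f] has the value 1 at the code of [w] if [w] is trivial in [G], and 0
    otherwise. Words are arbitrary, not only reduced. *)
Definition word_problem_decidable (G : groupType) (I : Type) (num : I -> nat)
    (gen : I -> G) : Prop :=
  exists2 f : 1.-tuple nat -> nat, recursive f &
    forall w : word I, f [tuple word_code num w] = (word_val gen w == 1).

(* Main.v *)
From HB Require Import structures.
Require Import Defs.
From mathcomp Require Import all_boot.
From mathcomp Require Import boolp classical_sets.
From mathcomp Require Import ssralg ssrnum ssrint zify.

Set Implicit Arguments.
Unset Strict Implicit.
Unset Printing Implicit Defensive.

(** Both parts come from one induction, due to Magnus, on the length of the
    cyclically reduced relator [r]. For a letter [a] of [r] it proves two
    properties of the subgroup generated by the other letters ([magnus]): these
    letters are a basis of it, and the words that represent elements outside of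
    it can be enumerated. The first property is the Freiheitssatz. The second
    one yields the word problem: the words equal to 1 are enumerable in any
    computable presentation ([enum_pw_eq1]); a word is different from 1 if and
    only if it is outside of the subgroup or equal to a nonempty reduced word on
    its basis ([enum_not_span_sub]); and an enumerable predicate with an
    enumerable complement is decidable ([enum_decidable]). Enumerability has the
    advantage over decidability that any certificate may be guessed, so that no
    rewriting algorithm has to be programmed.

    The inductive step chooses letters [s <> b] of [r] and weights of them for
    which [r] has total weight 0, the weight [al] of [b] being positive. With
    [b = x^al] and [(z, i)] for the conjugate [x^i z x^-i], the relator becomes a
    word [r0] in the letters [(z, i)] alone ([elim_word]). It is shorter, since
    [b] has disappeared, and still cyclically reduced ([elim_word_reduced]).
    Adding to the group of [r0] a stable letter [x] that shifts the indices
    gives an HNN extension: if [mu] and [M] are the extreme indices of [s] in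
    [r0], the shift goes from a subgroup that omits [(s, M)] to one that omits
    [(s, mu)], and the induction hypothesis says that both are free on the
    letters that remain. The group [G] of [r] maps to this extension ([Phi_pw]),
    and the extension acts on [al] copies of [G] in such a way that [x] is a
    root of [b] ([adj_root], [root_hnn_pw]); hence membership in subgroups of
    [G] can be read in the extension ([step_span_s], [step_span_b]). There,
    Britton's lemma ([britton]) describes the elements outside of the base, and
    the induction hypothesis those of the base ([enum_not_base]).

    If the exponent sum of [a] in [r] is 0, the letter [a] plays the role of
    [b], with weight 1 and all other weights 0. Otherwise [a] plays the role of
    [s] and [al] is the absolute value of its exponent sum. The induction starts
    with the powers of a letter, where the group is the free product of a free
    group and a finite cyclic group and has explicit normal forms
    ([magnus_power]). *)

(** * Recursive functions on natural numbers *)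

Definition rec1 (f : nat -> nat) : Prop :=
  recursive (fun v : 1.-tuple nat => f (thead v)).

Definition rec2 (f : nat -> nat -> nat) : Prop :=
  recursive (fun v : 2.-tuple nat => f (tnth v ord0) (tnth v (lift ord0 ord0))).

Lemma recursive_ext n (f g : n.-tuple nat -> nat) :
  recursive f -> f =1 g -> recursive g.
Proof. by move=> rf /funext <-. Qed.

Lemma recursive_comp1 n f (g : n.-tuple nat -> nat) :
  rec1 f -> recursive g -> recursive (fun v => f (g v)).
Proof.
move=> rf rg; apply: recursive_ext (recursive_comp (g := fun=> g) rf _) _ => //.
by move=> v; rewrite /thead tnth_mktuple.
Qed.

Lemma recursive_comp2 n f (g h : n.-tuple nat -> nat) :
  rec2 f -> recursive g -> recursive h -> recursive (fun v => f (g v) (h v)).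
Proof.
move=> rf rg rh.
apply: recursive_ext
  (recursive_comp (g := fun i : 'I_2 => if i == ord0 then g else h) rf _) _.
  by move=> i; case: ifP.
by move=> v; rewrite !tnth_mktuple.
Qed.

Lemma rec1_id : rec1 id.
Proof. exact: recursive_proj. Qed.

Lemma rec1_comp f g : rec1 f -> rec1 g -> rec1 (fun x => f (g x)).
Proof. exact: recursive_comp1. Qed.

Lemma rec1_comp2 f g h :
  rec2 f -> rec1 g -> rec1 h -> rec1 (fun x => f (g x) (h x)).
Proof. exact: recursive_comp2. Qed.

Lemma rec2_proj1 : rec2 (fun x _ => x).
Proof. exact: recursive_proj. Qed.

Lemma rec2_proj2 : rec2 (fun _ y => y).
Proof. exact: recursive_proj. Qed.

Lemma rec2_comp1 f g : rec1 f -> rec2 g -> rec2 (fun x y => f (g x y)).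
Proof. exact: recursive_comp1. Qed.

Lemma rec2_comp2 f g h :
  rec2 f -> rec2 g -> rec2 h -> rec2 (fun x y => f (g x y) (h x y)).
Proof. exact: recursive_comp2. Qed.

Lemma rec1_eq f g : rec1 f -> f =1 g -> rec1 g.
Proof. by move=> rf /funext <-. Qed.

Lemma rec2_eq f g : rec2 f -> f =2 g -> rec2 g.
Proof. by move=> rf eqfg; apply: recursive_ext rf _ => v; apply: eqfg. Qed.

Lemma rec1_succ : rec1 succn.
Proof. exact: recursive_succ. Qed.

Lemma rec1_const k : rec1 (fun=> k).
Proof.
elim: k => [|k IH]; first exact: recursive_zero.
exact: rec1_comp rec1_succ IH.
Qed.

Lemma rec2_iter f : rec1 f -> rec2 (fun n x => iter n f x).
Proof.
move=> rf.
have rg : recursive (fun v : 3.-tuple nat => f (tnth v (lift ord0 ord0))).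
  by apply: recursive_comp1 => //; apply: recursive_proj.
have rp := recursive_prim rec1_id rg.
apply: recursive_ext rp _ => v; rewrite /=.
rewrite (tnth_nth 0) (tnth_nth 0) /thead (tnth_nth 0) (tnth_nth 0) /=.
case: v => [[|a [|b [|]]]] //= _; rewrite /iter /iteri.
Qed.

Lemma rec1_pred : rec1 predn.
Proof.
have rg : recursive (fun v : 2.-tuple nat => tnth v ord0).
  exact: recursive_proj.
have rp := recursive_prim (recursive_zero 0) rg.
apply: recursive_ext rp _ => v; rewrite /=.
by elim: (thead v) => //= n _; rewrite (tnth_nth 0).
Qed.

Lemma rec2_sub : rec2 subn.
Proof.
apply: recursive_ext
  (rec2_comp2 (rec2_iter rec1_pred) rec2_proj2 rec2_proj1) _ => v.
by rewrite iter_predn.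
Qed.

Lemma rec2_add : rec2 addn.
Proof.
by apply: recursive_ext (rec2_iter rec1_succ) _ => v; rewrite iter_succn addnC.
Qed.

Lemma rec1_double : rec1 double.
Proof.
apply: recursive_ext (rec1_comp2 rec2_add rec1_id rec1_id) _ => v.
by rewrite addnn.
Qed.

Lemma rec1_min (t : nat -> nat -> nat) g : rec2 t ->
  (forall x, t (g x) x = 0 /\ forall y, y < g x -> t y x <> 0) -> rec1 g.
Proof.
move=> rt gP; apply: (recursive_min rt) => v; have [g0 gmin] := gP (thead v).
by case: v g0 gmin => [[|x [|]]] //= i; split.
Qed.

Lemma rec1_half : rec1 half.
Proof.
apply: (@rec1_min (fun m n => n - m.*2.+1)).
  apply: rec2_comp2 rec2_sub rec2_proj2 _.
  exact: rec2_comp1 rec1_succ (rec2_comp1 rec1_double rec2_proj1).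
move=> x; split=> [|y].
  apply/eqP; rewrite subn_eq0 -{1}[x]odd_double_half.
  by case: (odd x); rewrite ?add1n // leqW.
by move=> ltyx; lia.
Qed.

Lemma rec1_odd : rec1 odd.
Proof.
apply: (@rec1_eq (fun n => n - (n./2).*2)).
  apply: rec1_comp2 rec2_sub rec1_id _.
  exact: rec1_comp rec1_double rec1_half.
by move=> n; rewrite -{1}[n]odd_double_half addnK.
Qed.

(** The pairing underlying [CodeSeq.code]: the code of [x :: s] is [cpair x] of
    the code of [s]. *)
Definition cpair (x y : nat) : nat := 2 ^ x * y.*2.+1.
Definition cfst (n : nat) : nat := logn 2 n.
Definition csnd (n : nat) : nat := (iter (logn 2 n) half n)./2.

Lemma iter_half_mul k n : iter k half (2 ^ k * n) = n.
Proof.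
elim: k => [|k IH]; first by rewrite mul1n.
by rewrite iterSr expnS -mulnA mul2n doubleK IH.
Qed.

Lemma logn_cpair x y : logn 2 (cpair x y) = x.
Proof.
rewrite /cpair lognM ?expn_gt0 // pfactorK // logn_coprime ?addn0 //.
by rewrite coprime2n /= odd_double.
Qed.

Lemma cpairK1 x y : cfst (cpair x y) = x.
Proof. exact: logn_cpair. Qed.

Lemma cpairK2 x y : csnd (cpair x y) = y.
Proof.
rewrite /csnd logn_cpair iter_half_mul -[_.+1]/(true + _).
exact: half_bit_double.
Qed.

Lemma cpair_gt0 x y : 0 < cpair x y.
Proof. by rewrite muln_gt0 expn_gt0. Qed.

Lemma rec2_cpair : rec2 cpair.
Proof.
apply: (@rec2_eq (fun x y => iter x double y.*2.+1)).
  apply: rec2_comp2 (rec2_iter rec1_double) rec2_proj1 _.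
  exact: rec2_comp1 rec1_succ (rec2_comp1 rec1_double rec2_proj2).
move=> x y; elim: x => [|k IH]; first by rewrite /cpair mul1n.
by rewrite /= IH /cpair expnS -mulnA mul2n.
Qed.

(** The 2-adic valuation is the least number of halvings that lead to an odd
    number. The search is made total by the replacement of 0 by 1. *)
Lemma rec1_cfst : rec1 cfst.
Proof.
pose t n c := 1 - odd (iter n half (c + (1 - c))).
have rt : rec2 t.
  apply: rec2_comp2 rec2_sub (rec2_comp1 (rec1_const 1) rec2_proj1) _.
  apply: rec2_comp1 rec1_odd _.
  apply: rec2_comp2 (rec2_iter rec1_half) rec2_proj1 _.
  apply: rec2_comp2 rec2_add rec2_proj2 _.
  exact: rec2_comp2 rec2_sub (rec2_comp1 (rec1_const 1) rec2_proj1) rec2_proj2.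
apply: (rec1_min rt) => -[|x]; first by split.
rewrite /t subSS sub0n addn0 /cfst.
case: (pfactor_coprime (isT : prime 2) (ltn0Sn x)) => q; rewrite coprime2n => oq.
move: (logn 2 _) => k ->; rewrite mulnC iter_half_mul oq; split=> // y lty.
rewrite -(subnKC (ltnW lty)) expnD -mulnA iter_half_mul.
by rewrite -(prednK (_ : 0 < k - y)) ?subn_gt0 // expnS !oddM.
Qed.

Lemma rec1_csnd : rec1 csnd.
Proof.
apply: rec1_comp rec1_half _.
exact: rec1_comp2 (rec2_iter rec1_half) rec1_cfst rec1_id.
Qed.

Lemma rec1_cpair f g : rec1 f -> rec1 g -> rec1 (fun x => cpair (f x) (g x)).
Proof. exact: rec1_comp2 rec2_cpair. Qed.

(** A conditional is a loop: the state is the pair of the two results, and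
    a step overwrites the first one with the second one. *)
Lemma rec1_if c f g : rec1 c -> rec1 f -> rec1 g ->
  rec1 (fun x => if c x == 0 then g x else f x).
Proof.
move=> rc rf rg; pose step n := cpair (csnd n) (csnd n).
have rstep : rec1 step by apply: rec1_cpair; apply: rec1_csnd.
apply: (@rec1_eq (fun x => cfst (iter (c x) step (cpair (g x) (f x))))).
  apply: rec1_comp rec1_cfst _.
  exact: rec1_comp2 (rec2_iter rstep) rc (rec1_cpair rg rf).
move=> x; case: (c x) => [|k]; first by rewrite /= cpairK1.
suff -> : iter k.+1 step (cpair (g x) (f x)) = cpair (f x) (f x).
  by rewrite cpairK1.
by elim: k => [|k IH]; rewrite iterS ?IH /step /= cpairK2.
Qed.

(** * Computable functions between encoded types *)

(** As [dec] is total and [enc \o dec] recursive, a search through the natural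
    numbers is a search through [X], even if [enc] is not surjective. *)
Class encoding (X : Type) := Encoding {
  enc : X -> nat;
  dec : nat -> X;
  encK : cancel enc dec;
  rec1_encdec : rec1 (fun n => enc (dec n))
}.

Lemma enc_inj X (eX : encoding X) : injective enc.
Proof. exact: can_inj encK. Qed.

Definition computable X Y (eX : encoding X) (eY : encoding Y) (f : X -> Y) :=
  exists2 F : nat -> nat, rec1 F & forall x, F (enc x) = enc (f x).
Arguments computable {X Y eX eY} f.

Section Composition.
Context {X Y Z W : Type}.
Context {eX : encoding X} {eY : encoding Y} {eZ : encoding Z} {eW : encoding W}.

Lemma comp_id : computable (@id X).
Proof. by exists id => //; apply: rec1_id. Qed.

Lemma comp_const (y : Y) : computable (fun _ : X => y).
Proof. by exists (fun=> enc y) => //; apply: rec1_const. Qed.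

Lemma comp_comp (f : Y -> Z) (g : X -> Y) :
  computable f -> computable g -> computable (fun x => f (g x)).
Proof.
move=> [F rF FE] [H rH HE]; exists (fun n => F (H n)); first exact: rec1_comp.
by move=> x; rewrite HE FE.
Qed.

Lemma computable_eq (f g : X -> Y) : computable f -> f =1 g -> computable g.
Proof. by move=> cf /funext <-. Qed.

End Composition.

#[export] Instance enc_nat : encoding nat :=
  @Encoding nat id id (fun=> erefl) rec1_id.

#[export] Instance enc_bool : encoding bool.
Proof.
by apply: (@Encoding bool nat_of_bool odd); [case | exact: rec1_odd].
Defined.

#[export] Instance enc_pair X Y (eX : encoding X) (eY : encoding Y) :
  encoding (X * Y).
Proof.
apply: (@Encoding _ (fun p => cpair (enc p.1) (enc p.2))
                    (fun n => (dec (cfst n), dec (csnd n)))).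
  by move=> [x y] /=; rewrite cpairK1 cpairK2 !encK.
by apply: rec1_cpair; apply: (rec1_comp (rec1_encdec (X := _)));
  [exact: rec1_cfst | exact: rec1_csnd].
Defined.

#[export] Instance enc_option X (eX : encoding X) : encoding (option X).
Proof.
apply: (@Encoding _ (fun o => if o is Some x then (enc x).+1 else 0)
                    (fun n => if n is m.+1 then Some (dec m) else None)).
  by case=> //= x; rewrite encK.
apply: rec1_eq
  (rec1_if rec1_id (rec1_comp rec1_succ (rec1_comp rec1_encdec rec1_pred))
     (rec1_const 0)) _.
by case.
Defined.

(** The state of a loop over a coded list is
    [cpair context (cpair rest accumulator)]. The step does nothing at the end
    of the list, so that the code of the list, which bounds its length, can be
    used as the number of iterations. *)
Definition list_step (F : nat -> nat) (st : nat) : nat :=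
  if cfst (csnd st) == 0 then st else
  cpair (cfst st) (cpair (csnd (cfst (csnd st)))
    (F (cpair (cfst st) (cpair (cfst (cfst (csnd st))) (csnd (csnd st)))))).

Lemma rec1_list_step F : rec1 F -> rec1 (list_step F).
Proof.
have r1 := rec1_cfst; have r2 := rec1_csnd.
have r12 : rec1 (fun n => cfst (csnd n)) by apply: rec1_comp.
have r22 : rec1 (fun n => csnd (csnd n)) by apply: rec1_comp.
move=> rF; apply: (rec1_if (c := fun n => cfst (csnd n))) => //; last first.
  exact: rec1_id.
apply: rec1_cpair => //; apply: rec1_cpair.
  by apply: rec1_comp.
apply: (rec1_comp rF); apply: rec1_cpair => //; apply: rec1_cpair => //.
exact: rec1_comp.
Qed.

Section ListEncoding.
Context {X : Type} {eX : encoding X}.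

Definition enc_list (s : seq X) : nat := CodeSeq.code (map enc s).

Lemma enc_list_cons x s : enc_list (x :: s) = cpair (enc x) (enc_list s).
Proof. by []. Qed.

Lemma size_enc_list s : size s <= enc_list s.
Proof.
elim: s => //= x s IH; rewrite enc_list_cons /cpair.
apply: (@leq_trans (enc_list s).*2.+1); last by rewrite leq_pmull ?expn_gt0.
by rewrite ltnS (leq_trans IH) // -addnn leq_addr.
Qed.

Lemma iter_list_step F n c (s : seq nat) a : size s <= n ->
  iter n (list_step F) (cpair c (cpair (CodeSeq.code s) a)) =
  cpair c (cpair 0 (foldl (fun a x => F (cpair c (cpair x a))) a s)).
Proof.
elim: s n a => [|x s IH] n a /=.
  move=> _; elim: n => //= n ->; rewrite /list_step !cpairK2 cpairK1 //.
case: n => // n lsn; rewrite iterSr -/(cpair x _) -(IH n) //; congr iter.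
rewrite /list_step !cpairK2 !cpairK1 cpairK2.
by rewrite (gtn_eqF (cpair_gt0 _ _)).
Qed.

End ListEncoding.

Lemma rec1_foldl F c i l : rec1 F -> rec1 c -> rec1 i -> rec1 l ->
  rec1 (fun n => foldl (fun a x => F (cpair (c n) (cpair x a))) (i n)
                   (CodeSeq.decode (l n))).
Proof.
move=> rF rc ri rl.
apply: (@rec1_eq (fun n => csnd (csnd
  (iter (l n) (list_step F) (cpair (c n) (cpair (l n) (i n))))))).
  apply: (rec1_comp rec1_csnd); apply: (rec1_comp rec1_csnd).
  apply: (rec1_comp2 (rec2_iter (rec1_list_step rF)) rl).
  by apply: rec1_cpair => //; apply: rec1_cpair.
move=> n /=; rewrite -{2}(CodeSeq.decodeK (l n)) iter_list_step ?cpairK2 //.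
rewrite -{2}(CodeSeq.decodeK (l n)) -{2}[CodeSeq.decode _](map_id).
exact: (@size_enc_list nat).
Qed.

Lemma code_foldl_cons s t :
  foldl (fun a x => cpair x a) (CodeSeq.code t) s = CodeSeq.code (catrev s t).
Proof. by elim: s t => //= x s IH t; rewrite -IH. Qed.

Lemma rec1_code_map F : rec1 F ->
  rec1 (fun n => CodeSeq.code (map F (CodeSeq.decode n))).
Proof.
move=> rF; have r0 := rec1_const 0.
have r1 : rec1 (fun n => CodeSeq.code (rev (map F (CodeSeq.decode n)))).
  have rG : rec1 (fun n => cpair (F (cfst (csnd n))) (csnd (csnd n))).
    apply: rec1_cpair; last exact: rec1_comp rec1_csnd rec1_csnd.
    exact: rec1_comp rF (rec1_comp rec1_cfst rec1_csnd).
  apply: rec1_eq (rec1_foldl rG r0 r0 rec1_id) _ => n.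
  rewrite /rev -code_foldl_cons.
  have E s a : foldl (fun a x => cpair
      (F (cfst (csnd (cpair 0 (cpair x a))))) (csnd (csnd (cpair 0 (cpair x a)))))
      a s = foldl (fun a x => cpair x a) a (map F s).
    by elim: s a => //= x s IH a; rewrite IH !cpairK2 cpairK1.
  exact: E.
apply: rec1_eq (rec1_comp r1 (rec1_foldl rec1_csnd r0 r0 rec1_id)) _ => n.
rewrite (_ : foldl _ 0 _ = CodeSeq.code (rev (CodeSeq.decode n))).
  by rewrite CodeSeq.codeK map_rev revK.
rewrite /rev -code_foldl_cons.
have E s a : foldl (fun a x => csnd (cpair 0 (cpair x a))) a s =
    foldl (fun a x => cpair x a) a s.
  by elim: s a => //= x s IH a; rewrite IH cpairK2.
exact: E.
Qed.

#[export] Instance enc_seq X (eX : encoding X) : encoding (seq X).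
Proof.
apply: (@Encoding _ enc_list (fun n => map dec (CodeSeq.decode n))).
  by move=> s; rewrite /enc_list CodeSeq.codeK (mapK encK).
apply: rec1_eq (rec1_code_map (rec1_encdec (X := X))) _ => n.
by rewrite /enc_list -map_comp.
Defined.

Section Pairing.
Context {X Y Z W : Type}.
Context {eX : encoding X} {eY : encoding Y} {eZ : encoding Z} {eW : encoding W}.

Lemma comp_pair (f : X -> Y) (g : X -> Z) :
  computable f -> computable g -> computable (fun x => (f x, g x)).
Proof.
move=> [F rF FE] [G rG GE]; exists (fun n => cpair (F n) (G n)).
  exact: rec1_cpair.
by move=> x; rewrite FE GE.
Qed.

End Pairing.

Section DataTypes.
Context {X Y Z W : Type}.
Context {eX : encoding X} {eY : encoding Y} {eZ : encoding Z} {eW : encoding W}.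

Lemma comp_app2 (f : Y -> Z -> W) (g : X -> Y) (h : X -> Z) :
  computable (fun p : Y * Z => f p.1 p.2) -> computable g -> computable h ->
  computable (fun x => f (g x) (h x)).
Proof. by move=> cf cg ch; apply: (comp_comp cf (comp_pair cg ch)). Qed.

Lemma comp_fst (f : X -> Y * Z) : computable f -> computable (fun x => (f x).1).
Proof.
move=> [F rF FE]; exists (fun n => cfst (F n)).
  exact: rec1_comp rec1_cfst rF.
by move=> x; rewrite FE [LHS]cpairK1.
Qed.

Lemma comp_snd (f : X -> Y * Z) : computable f -> computable (fun x => (f x).2).
Proof.
move=> [F rF FE]; exists (fun n => csnd (F n)).
  exact: rec1_comp rec1_csnd rF.
by move=> x; rewrite FE [LHS]cpairK2.
Qed.

Lemma comp_if (b : X -> bool) (f g : X -> Y) :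
  computable b -> computable f -> computable g ->
  computable (fun x => if b x then f x else g x).
Proof.
move=> [B rB BE] [F rF FE] [G rG GE].
exists (fun n => if B n == 0 then G n else F n); first exact: rec1_if.
by move=> x; rewrite BE FE GE; case: (b x).
Qed.

Lemma comp_cons (f : X -> Y) (l : X -> seq Y) :
  computable f -> computable l -> computable (fun x => f x :: l x).
Proof.
move=> [F rF FE] [L rL LE]; exists (fun n => cpair (F n) (L n)).
  exact: rec1_cpair.
by move=> x; rewrite FE LE.
Qed.

Lemma comp_case (h : X -> Y -> seq Y -> Z) (d : X -> Z) (l : X -> seq Y) :
  computable (fun p : X * (Y * seq Y) => h p.1 p.2.1 p.2.2) ->
  computable d -> computable l ->
  computable (fun x => if l x is y :: s then h x y s else d x).
Proof.
move=> [H rH HE] [D rD DE] [L rL LE].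
exists (fun n => if L n == 0 then D n else H (cpair n (L n))).
  apply: rec1_if => //; apply: (rec1_comp rH).
  by apply: rec1_cpair => //; apply: rec1_id.
move=> x; rewrite LE DE; case: (l x) => [|y s] //=.
rewrite enc_list_cons gtn_eqF ?cpair_gt0 //.
exact: (HE (x, (y, s))).
Qed.

Lemma comp_Some (f : X -> Y) : computable f -> computable (fun x => Some (f x)).
Proof.
move=> [F rF FE]; exists (fun n => (F n).+1).
  exact: rec1_comp rec1_succ rF.
by move=> x; rewrite FE.
Qed.

Lemma comp_option (h : X -> Y -> Z) (d : X -> Z) (o : X -> option Y) :
  computable (fun p : X * Y => h p.1 p.2) -> computable d -> computable o ->
  computable (fun x => if o x is Some y then h x y else d x).
Proof.
move=> [H rH HE] [D rD DE] [O rO OE].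
exists (fun n => if O n == 0 then D n else H (cpair n (O n).-1)).
  apply: rec1_if => //; apply: (rec1_comp rH).
  by apply: rec1_cpair; [apply: rec1_id | apply: rec1_comp rec1_pred rO].
move=> x; rewrite OE DE; case: (o x) => [y|] //=.
exact: (HE (x, y)).
Qed.

Lemma comp_foldl (g : X -> Z -> Y -> Z) (i : X -> Z) (l : X -> seq Y) :
  computable (fun p : X * (Y * Z) => g p.1 p.2.2 p.2.1) ->
  computable i -> computable l ->
  computable (fun x => foldl (g x) (i x) (l x)).
Proof.
move=> [G rG GE] [I rI IE] [L rL LE].
exists (fun n => foldl (fun a x => G (cpair n (cpair x a))) (I n)
                   (CodeSeq.decode (L n))).
  exact: (rec1_foldl rG rec1_id rI rL).
move=> x; rewrite LE IE /= /enc_list CodeSeq.codeK.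
elim: (l x) (i x) => //= y s IH a; rewrite -IH; congr foldl.
exact: (GE (x, (y, a))).
Qed.

Lemma comp_iter (f : Y -> Y) (i : X -> Y) (n : X -> nat) :
  computable f -> computable i -> computable n ->
  computable (fun x => iter (n x) f (i x)).
Proof.
move=> [F rF FE] [I rI IE] [N rN NE].
exists (fun m => iter (N m) F (I m)); first exact: rec1_comp2 (rec2_iter rF) _ _.
by move=> x; rewrite NE IE /=; elim: (n x) => //= m ->; rewrite FE.
Qed.

Lemma comp_eq (T : eqType) (eT : encoding T) (f g : X -> T) :
  computable f -> computable g -> computable (fun x => f x == g x).
Proof.
move=> [F rF FE] [G rG GE].
exists (fun n => if (F n - G n) + (G n - F n) == 0 then 1 else 0).
  apply: rec1_if; [|exact: rec1_const|exact: rec1_const].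
  by apply: (rec1_comp2 rec2_add); apply: (rec1_comp2 rec2_sub).
move=> x; rewrite FE GE addn_eq0 !subn_eq0 -eqn_leq (inj_eq (@enc_inj _ eT)).
by case: eqP.
Qed.

End DataTypes.

Section Folds.
Context {X Y Z : Type}.
Context {eX : encoding X} {eY : encoding Y} {eZ : encoding Z}.

Lemma comp_catrev (l m : X -> seq Y) :
  computable l -> computable m -> computable (fun x => catrev (l x) (m x)).
Proof.
move=> cl cm; apply: (@computable_eq _ _ _ _
  (fun x => foldl (fun a y => y :: a) (m x) (l x))).
  apply: (comp_foldl (g := fun _ a y => y :: a)) => //.
  apply: comp_cons; first exact: comp_fst (comp_snd comp_id).
  exact: comp_snd (comp_snd comp_id).
by move=> x; elim: (l x) (m x) => //= y s IH t; rewrite IH.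
Qed.

Lemma comp_rev (l : X -> seq Y) :
  computable l -> computable (fun x => rev (l x)).
Proof. by move=> cl; apply: comp_catrev => //; apply: comp_const. Qed.

Lemma comp_cat (l m : X -> seq Y) :
  computable l -> computable m -> computable (fun x => l x ++ m x).
Proof.
move=> cl cm; apply: computable_eq (comp_catrev (comp_rev cl) cm) _ => x.
by rewrite catrevE revK.
Qed.

Lemma comp_foldr (g : X -> Y -> Z -> Z) (i : X -> Z) (l : X -> seq Y) :
  computable (fun p : X * (Y * Z) => g p.1 p.2.1 p.2.2) ->
  computable i -> computable l ->
  computable (fun x => foldr (g x) (i x) (l x)).
Proof.
move=> cg ci cl; apply: (@computable_eq _ _ _ _
  (fun x => foldl (fun a y => g x y a) (i x) (rev (l x)))).
  by apply: (comp_foldl (g := fun x a y => g x y a)) => //; apply: comp_rev.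
by move=> x; rewrite foldl_rev.
Qed.

End Folds.

Section MapList.
Context {X Y Z : Type}.
Context {eX : encoding X} {eY : encoding Y} {eZ : encoding Z}.

Lemma comp_map (g : X -> Y -> Z) (l : X -> seq Y) :
  computable (fun p : X * Y => g p.1 p.2) -> computable l ->
  computable (fun x => map (g x) (l x)).
Proof.
move=> cg cl; apply: (@computable_eq _ _ _ _
  (fun x => foldr (fun y s => g x y :: s) [::] (l x))) => //.
apply: (comp_foldr (g := fun x y s => g x y :: s) (i := fun=> [::])) => //; last exact: comp_const.
apply: comp_cons; last exact: comp_snd (comp_snd comp_id).
exact: comp_app2 cg (comp_fst comp_id) (comp_fst (comp_snd comp_id)).
Qed.

End MapList.

Section Concatenation.
Context {X Y Z : Type}.
Context {eX : encoding X} {eY : encoding Y} {eZ : encoding Z}.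

Lemma comp_flatten (l : X -> seq (seq Y)) :
  computable l -> computable (fun x => flatten (l x)).
Proof.
move=> cl; apply: (comp_foldr (g := fun _ y s => y ++ s) (i := fun=> [::])) => //.
  apply: comp_cat; first exact: comp_fst (comp_snd comp_id).
  exact: comp_snd (comp_snd comp_id).
exact: comp_const.
Qed.

End Concatenation.

Section Booleans.
Context {X Y Z : Type}.
Context {eX : encoding X} {eY : encoding Y} {eZ : encoding Z}.

Lemma comp_negb (b : X -> bool) :
  computable b -> computable (fun x => ~~ b x).
Proof. by move=> cb; apply: comp_if => //; apply: comp_const. Qed.

Lemma comp_andb (b c : X -> bool) :
  computable b -> computable c -> computable (fun x => b x && c x).
Proof. by move=> cb cc; apply: comp_if => //; apply: comp_const. Qed.

Lemma comp_orb (b c : X -> bool) :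
  computable b -> computable c -> computable (fun x => b x || c x).
Proof. by move=> cb cc; apply: comp_if => //; apply: comp_const. Qed.

End Booleans.

Section Quantifiers.
Context {X Y Z : Type}.
Context {eX : encoding X} {eY : encoding Y} {eZ : encoding Z}.

Lemma comp_all (p : X -> Y -> bool) (l : X -> seq Y) :
  computable (fun q : X * Y => p q.1 q.2) -> computable l ->
  computable (fun x => all (p x) (l x)).
Proof.
move=> cp cl; apply: (@computable_eq _ _ _ _
  (fun x => foldr (fun y a => p x y && a) true (l x))) => //.
apply: (comp_foldr (g := fun x y a => p x y && a) (i := fun=> true)) => //; last exact: comp_const.
apply: comp_andb; last exact: comp_snd (comp_snd comp_id).
exact: comp_app2 cp (comp_fst comp_id) (comp_fst (comp_snd comp_id)).
Qed.

End Quantifiers.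

Section BoundedSearch.
Context {X Y Z : Type}.
Context {eX : encoding X} {eY : encoding Y} {eZ : encoding Z}.

Lemma comp_has (p : X -> Y -> bool) (l : X -> seq Y) :
  computable (fun q : X * Y => p q.1 q.2) -> computable l ->
  computable (fun x => has (p x) (l x)).
Proof.
move=> cp cl; apply: (@computable_eq _ _ _ _
  (fun x => ~~ all (fun y => ~~ p x y) (l x))).
  by apply: comp_negb; apply: comp_all => //; apply: comp_negb.
by move=> x; rewrite -has_predC; apply: eq_has => y /=; rewrite negbK.
Qed.

Lemma comp_iota (n : X -> nat) :
  computable n -> computable (fun x => iota 0 (n x)).
Proof.
move=> cn; pose step (p : nat * seq nat) := (p.1.+1, p.1 :: p.2).
have cs : computable step.
  apply: comp_pair.
    apply: (comp_comp (f := succn)); last exact: comp_fst comp_id.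
    by exists succn => //; apply: rec1_succ.
  exact: comp_cons (comp_fst comp_id) (comp_snd comp_id).
apply: (@computable_eq _ _ _ _ (fun x => rev (iter (n x) step (0, [::])).2)).
  by apply/comp_rev/comp_snd/comp_iter => //; apply: comp_const.
move=> x; have -> k : iter k step (0, [::]) = (k, rev (iota 0 k)).
  elim: k => // k IH; rewrite iterS IH /step /=.
  by rewrite -[0 :: _]/(iota 0 k.+1) -addn1 iotaD rev_cat addn1.
by rewrite revK.
Qed.

End BoundedSearch.

(** * Recursively enumerable predicates *)

Definition enumerable X (eX : encoding X) (P : X -> Prop) :=
  exists2 b : X * nat -> bool, computable b & forall x, P x <-> exists n, b (x, n).
Arguments enumerable {X eX} P.

Section Enumerable.
Context {X Y : Type} {eX : encoding X} {eY : encoding Y}.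
Implicit Types P Q : X -> Prop.

Lemma enum_iff P Q : (forall x, P x <-> Q x) -> enumerable P -> enumerable Q.
Proof.
by move=> PQ [b cb bP]; exists b => // x; rewrite -bP; symmetry.
Qed.

Lemma enum_dec (b : X -> bool) : computable b -> enumerable (fun x => b x).
Proof.
move=> cb; exists (fun p => b p.1); first exact: comp_comp cb (comp_fst comp_id).
by move=> x; split=> [|[]] //; exists 0.
Qed.

Lemma enum_comp (P : Y -> Prop) (f : X -> Y) :
  enumerable P -> computable f -> enumerable (fun x => P (f x)).
Proof.
move=> [b cb bP] cf; exists (fun p => b (f p.1, p.2)); last by move=> x.
apply: (comp_comp cb); apply: comp_pair; last exact: comp_snd comp_id.
exact: comp_comp cf (comp_fst comp_id).
Qed.

(** A certificate is a pair of the code of a witness and of a certificate for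
    it. *)
Lemma enum_ex (Q : X -> Y -> Prop) :
  enumerable (fun p : X * Y => Q p.1 p.2) -> enumerable (fun x => exists y, Q x y).
Proof.
move=> [b cb bP].
exists (fun p : X * nat => b (p.1, dec (cfst p.2), csnd p.2)).
  have cd : computable (@dec _ eY).
    by exists (fun n => enc (dec (encoding := eY) n)) => //; apply: rec1_encdec.
  have c1 : computable (fun n : nat => cfst n).
    by exists cfst => //; apply: rec1_cfst.
  have c2 : computable (fun n : nat => csnd n).
    by exists csnd => //; apply: rec1_csnd.
  have cs : computable (fun p : X * nat => p.2) by exact: comp_snd comp_id.
  apply: (comp_comp cb); apply: comp_pair; last exact: comp_comp c2 cs.
  apply: comp_pair; first exact: comp_fst comp_id.
  exact: comp_comp cd (comp_comp c1 cs).
move=> x; split=> [[y /(bP (x, y)) [n bn]]|[n bn]].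
  by exists (cpair (enc y) n); rewrite cpairK1 cpairK2 encK.
by exists (dec (cfst n)); apply/(bP (_, _)); exists (csnd n).
Qed.

Lemma enum_and P Q :
  enumerable P -> enumerable Q -> enumerable (fun x => P x /\ Q x).
Proof.
move=> [b cb bP] [c cc cQ].
exists (fun p : X * nat => b (p.1, cfst p.2) && c (p.1, csnd p.2)).
  have c1 : computable (fun n : nat => cfst n).
    by exists cfst => //; apply: rec1_cfst.
  have c2 : computable (fun n : nat => csnd n).
    by exists csnd => //; apply: rec1_csnd.
  have cs : computable (fun p : X * nat => p.2) by exact: comp_snd comp_id.
  by apply: comp_andb; [apply: (comp_comp cb)|apply: (comp_comp cc)];
    apply: comp_pair (comp_fst comp_id) _; [apply: comp_comp c1 cs
    |apply: comp_comp c2 cs].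
move=> x; rewrite bP cQ; split=> [[[n bn] [m cm]]|[n /andP[]]].
  by exists (cpair n m); rewrite cpairK1 cpairK2 bn.
by split; eexists; eassumption.
Qed.

Lemma enum_or P Q :
  enumerable P -> enumerable Q -> enumerable (fun x => P x \/ Q x).
Proof.
move=> [b cb bP] [c cc cQ].
exists (fun p : X * nat => b p || c p); first exact: comp_orb.
move=> x; rewrite bP cQ; split=> [[[n bn]|[n cn]]|[n /orP[]]].
- by exists n; rewrite bn.
- by exists n; rewrite cn orbT.
- by left; exists n.
- by right; exists n.
Qed.

End Enumerable.

(** Finitely many certificates have a common bound, which is a certificate for
    all the elements of a list. *)
Lemma enum_all X (Y : eqType) (eX : encoding X) (eY : encoding Y)
    (Q : X -> Y -> Prop) (l : X -> seq Y) :
  enumerable (fun p : X * Y => Q p.1 p.2) -> computable l ->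
  enumerable (fun x => forall y, y \in l x -> Q x y).
Proof.
move=> [b cb bP] cl.
exists (fun p => all (fun y => has (fun k => b (p.1, y, k)) (iota 0 p.2)) (l p.1)).
  apply: (comp_all
    (p := fun (p : X * nat) y => has (fun k => b (p.1, y, k)) (iota 0 p.2))).
    apply: (comp_has (p := fun (p : X * nat * Y) k => b (p.1.1, p.2, k))).
      apply: (comp_comp cb); apply: comp_pair; last exact: comp_snd comp_id.
      apply: comp_pair.
        exact: comp_fst (comp_fst (comp_fst comp_id)).
      exact: comp_snd (comp_fst comp_id).
    by apply/comp_iota/comp_snd/comp_fst/comp_id.
  exact: comp_comp cl (comp_fst comp_id).
move=> x; split=> [|[n /allP allb] y /allb /hasP[k _ bk]]; last first.
  by apply/(bP (x, y)); exists k.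
move: (l x) => s; elim: s => [|y s IH] Qs; first by exists 0.
have [|n /= /allP bn] := IH; first by move=> z zs; apply: Qs; rewrite inE zs orbT.
have [|k bk] := (bP (x, y)).1 _; first by apply: Qs; rewrite inE eqxx.
exists (maxn n k.+1); apply/andP; split.
  by apply/hasP; exists k; rewrite // mem_iota leq_max ltnSn orbT.
apply/allP => z /bn /hasP[j]; rewrite mem_iota /= => ltj bj.
by apply/hasP; exists j; rewrite // mem_iota leq_max ltj.
Qed.

(** Post: an enumerable predicate with an enumerable complement is decided by
    the search for a witness of either. *)
Lemma enum_decidable X (eX : encoding X) (P : X -> Prop) :
  enumerable P -> enumerable (fun x => ~ P x) ->
  exists2 b : X -> bool, computable b & forall x, b x <-> P x.
Proof.
move=> [b cb bP] [c cc cP].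
have [B rB BE] := cb; have [C rC CE] := cc.
have search x : exists n, b (x, n) || c (x, n).
  have [/bP[n bn]|/cP[n cn]] := pselect (P x); exists n; first by rewrite bn.
  by rewrite cn orbT.
pose g x := ex_minn (search x).
have rg : rec1 (fun n => g (dec n)).
  apply: (@rec1_min (fun n m => 1 - (B (cpair (enc (dec (encoding := eX) m)) n) +
                                     C (cpair (enc (dec (encoding := eX) m)) n)))).
    have r2 : rec2 (fun n m => cpair (enc (dec (encoding := eX) m)) n).
      apply: rec2_comp2 rec2_cpair _ rec2_proj1.
      exact: rec2_comp1 rec1_encdec rec2_proj2.
    apply: rec2_comp2 rec2_sub (rec2_comp1 (rec1_const 1) r2) _.
    by apply: rec2_comp2 rec2_add _ _; apply: rec2_comp1 r2.
  move=> n; rewrite /g; case: ex_minnP => m bcm minm.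
  rewrite (BE (dec n, m)) (CE (dec n, m)); split.
    by case/orP: bcm => /= ->; rewrite ?addn1.
  move=> k ltkm; rewrite (BE (dec n, k)) (CE (dec n, k)) => Ek.
  move: Ek (minm k) => /=; rewrite leqNgt ltkm.
  by case: (b _) (c _) => [] [] //= _ /(_ isT).
exists (fun x => b (x, g x)).
  apply: (comp_comp cb); apply: comp_pair; first exact: comp_id.
  by exists (fun n => g (dec n)) => // x; rewrite encK.
move=> x; rewrite /g; case: ex_minnP => m bcm _; split=> [bm|Px].
  by apply/bP; exists m.
by case/orP: bcm => // cm; case: ((cP x).2 _ Px); exists m.
Qed.

Local Open Scope classical_set_scope.
Local Open Scope group_scope.

(** * Words and presented groups *)

Section Words.
Variable A : Type.
Implicit Types (u v w : word A) (S : set (free_group A)) (D : A -> bool).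

Definition fgw w : free_group A :=
  FreeGroup (word_mul_reduced w (isT : reduced ([::] : word A))).

Lemma word_mul_cat u v (z : word A) :
  word_mul (u ++ v) z = word_mul u (word_mul v z).
Proof. exact: foldr_cat. Qed.

Lemma fgw_cat u v : fgw (u ++ v) = fgw u * fgw v.
Proof.
apply: val_inj; rewrite /= word_mul_cat.
exact: (@word_mulA _ u [::] (fgw v) isT (fg_reduced _)).
Qed.

Lemma fgw_nil : fgw [::] = 1.
Proof. by apply: val_inj. Qed.

Lemma fgw_id (u : free_group A) : fgw u = u.
Proof. by apply: val_inj; rewrite /= word_mul1 ?fg_reduced. Qed.

Lemma fgw_letterV x : fgw [:: x; letter_inv x] = 1.
Proof. by apply: val_inj => /=; rewrite asboolT. Qed.

Lemma word_inv_cons x w : word_inv (x :: w) = word_inv w ++ [:: letter_inv x].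
Proof. by rewrite /word_inv /= rev_cons cats1. Qed.

Lemma fgw_inv w : fgw (word_inv w) = (fgw w)^-1.
Proof.
elim: w => [|x w IH]; first by rewrite fgw_nil invg1.
rewrite word_inv_cons fgw_cat IH -[x :: w]cat1s fgw_cat invgM.
congr (_ * _); apply: (mulgI (fgw [:: x])).
by rewrite mulgV -fgw_cat -(fgw_letterV x).
Qed.

Section Eval.
Variables (G : groupType) (gen : A -> G).

Definition letter_val (x : A * bool) : G :=
  if x.2 then (gen x.1)^-1 else gen x.1.

Lemma letter_valV x : letter_val (letter_inv x) = (letter_val x)^-1.
Proof. by case: x => a []; rewrite /letter_val /= ?invgK. Qed.

Lemma word_val_nil : word_val gen [::] = 1.
Proof. exact: big_nil. Qed.

Lemma word_valE x w : word_val gen (x :: w) = letter_val x * word_val gen w.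
Proof. exact: word_val_cons. Qed.

Lemma word_val_cat u v : word_val gen (u ++ v) = word_val gen u * word_val gen v.
Proof. exact: big_cat. Qed.

Lemma word_val1 x : word_val gen [:: x] = letter_val x.
Proof. exact: big_seq1. Qed.

Lemma word_val_inv w : word_val gen (word_inv w) = (word_val gen w)^-1.
Proof.
elim: w => [|x w IH]; first by rewrite word_val_nil invg1.
by rewrite word_inv_cons word_val_cat IH word_val1 word_valE invgM letter_valV.
Qed.

Lemma word_val_fgw w : word_val gen (fgw w) = word_val gen w.
Proof.
elim: w => [|x w IH] //.
by rewrite -[fg_word _]/(push x (fgw w)) word_val_push !word_valE IH.
Qed.

Lemma word_val_eq u v : fgw u = fgw v -> word_val gen u = word_val gen v.
Proof. by move=> uv; rewrite -word_val_fgw uv word_val_fgw. Qed.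

End Eval.

(** The element of the presented group represented by a word. *)
Definition pw S w : quotient_group S := quot_map S (fgw w).

Lemma quot_mapV S (x : free_group A) : quot_map S x^-1 = (quot_map S x)^-1.
Proof. exact: gmulfV. Qed.

Lemma quot_mapJ S (x y : free_group A) :
  quot_map S (x ^ y) = quot_map S x ^ quot_map S y.
Proof. exact: gmulfJ. Qed.

Lemma pw_cat S u v : pw S (u ++ v) = pw S u * pw S v.
Proof. by rewrite /pw fgw_cat quot_mapM. Qed.

Lemma pw_nil S : pw S [::] = 1.
Proof. by rewrite /pw fgw_nil. Qed.

Lemma pw_inv S w : pw S (word_inv w) = (pw S w)^-1.
Proof. by rewrite /pw fgw_inv gmulfV. Qed.

Lemma pw_eq S u v : fgw u = fgw v -> pw S u = pw S v.
Proof. by rewrite /pw => ->. Qed.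

Lemma pw_fgw S w : pw S (fgw w) = pw S w.
Proof. by rewrite /pw fgw_id. Qed.

Lemma pw_cons S x w : pw S (x :: w) = pw S [:: x] * pw S w.
Proof. by rewrite -pw_cat. Qed.

Lemma pw_word_val S w :
  pw S w = word_val (fun a => quot_map S (free_gen a)) w.
Proof.
elim: w => [|x w IH]; first by rewrite word_val_nil pw_nil.
rewrite word_valE pw_cons IH; congr (_ * _).
rewrite /letter_val; case: x => a [] /=.
  rewrite -gmulfV; congr quot_map; exact: val_inj.
by congr quot_map; apply: val_inj.
Qed.

Lemma pw_eqP S u v : pw S u = pw S v <-> normal_closure S (fgw u / fgw v).
Proof. exact: quot_mapP. Qed.

Lemma pw_eq1P S w : pw S w = 1 <-> normal_closure S (fgw w).
Proof.
by rewrite -(pw_nil S) pw_eqP fgw_nil invg1 mulg1.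
Qed.

Lemma pw_rel S w : S (fgw w) -> pw S w = 1.
Proof. by move=> Sw; apply/pw_eq1P => N _; apply. Qed.

Lemma normal_closure_preim S (G : groupType) (gen : A -> G) :
  (forall s : free_group A, S s -> word_val gen s = 1) ->
  forall x : free_group A, normal_closure S x -> word_val gen x = 1.
Proof.
move=> gS x nx; apply: (nx [set y : free_group A | word_val gen y = 1]) => //.
have gM (y z : free_group A) :
    word_val gen (y * z)%g = word_val gen y * word_val gen z.
  exact: (free_liftM gen).
have gV (y : free_group A) : word_val gen (y^-1)%g = (word_val gen y)^-1.
  exact: word_val_inv.
split=> [|y z yE zE|y z yE]; first exact: word_val_nil.
  change (word_val gen (y / z)%g = 1).
  by rewrite gM gV [word_val gen y]yE [word_val gen z]zE invg1 mulg1.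
change (word_val gen (y ^ z)%g = 1).
by rewrite conjgE !gM gV [word_val gen y]yE mul1g mulVg.
Qed.

(** Universal property of the presented group. *)
Lemma pw_lift S (G : groupType) (gen : A -> G) :
  (forall s : free_group A, S s -> word_val gen s = 1) ->
  forall u v, pw S u = pw S v -> word_val gen u = word_val gen v.
Proof.
move=> gS u v /pw_eqP /(normal_closure_preim gS) E.
apply: (mulIg (word_val gen v)^-1); rewrite mulgV -word_val_inv -word_val_cat.
by rewrite -E -word_val_fgw fgw_cat fgw_inv.
Qed.

Definition word_over D w := all (fun x => D x.1) w.

Lemma word_over_cat D u v : word_over D (u ++ v) = word_over D u && word_over D v.
Proof. exact: all_cat. Qed.

Lemma word_over_inv D w : word_over D (word_inv w) = word_over D w.
Proof. by rewrite /word_over /word_inv all_rev all_map. Qed.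

Lemma word_over_push D x w : D x.1 -> word_over D w -> word_over D (push x w).
Proof.
move=> Dx; case: w => [|y w] /=; first by rewrite Dx.
by case/andP=> Dy Dw; case: asboolP => //=; rewrite Dx Dy.
Qed.

Lemma word_over_fgw D w : word_over D w -> word_over D (fgw w).
Proof.
by elim: w => //= x w IH /andP[Dx /IH]; rewrite -/(word_over D (push x (fgw w)));
  apply: word_over_push.
Qed.

(** The subgroup generated by the letters in [D]. *)
Definition word_span S D : set (quotient_group S) :=
  [set g | exists2 u, word_over D u & g = pw S u].

(** The letters in [D] are a basis of the subgroup that they generate. *)
Definition free_on S D :=
  forall w, reduced w -> word_over D w -> pw S w = 1 -> w = [::].

Lemma free_on_inj S D u v : free_on S D -> word_over D u -> word_over D v ->
  pw S u = pw S v -> fgw u = fgw v.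
Proof.
move=> fD Du Dv uv; have : fgw (u ++ word_inv v) = [::] :> word A.
  apply: fD; first exact: fg_reduced.
    by apply: word_over_fgw; rewrite word_over_cat word_over_inv Du.
  by rewrite pw_fgw pw_cat pw_inv uv mulgV.
rewrite -[RHS]/(fg_word 1) => /val_inj; rewrite fgw_cat fgw_inv.
exact: divg1_eq.
Qed.

Lemma free_on_sub S D D' : (forall a, D a -> D' a) -> free_on S D' -> free_on S D.
Proof.
by move=> DD' fD w rw Dw; apply: fD => //; apply: sub_all Dw => x /DD'.
Qed.

Lemma word_span1 S D : word_span D (1 : quotient_group S).
Proof. by exists [::] => //; rewrite pw_nil. Qed.

Lemma word_spanM S D (g h : quotient_group S) :
  word_span D g -> word_span D h -> word_span D (g * h).
Proof.
move=> [u Du ->] [v Dv ->]; exists (u ++ v); last by rewrite pw_cat.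
by rewrite word_over_cat Du.
Qed.

Lemma word_spanV S D (g : quotient_group S) : word_span D g -> word_span D g^-1.
Proof.
move=> [u Du ->]; exists (word_inv u); last by rewrite pw_inv.
by rewrite word_over_inv.
Qed.

(** Words act through the free group as soon as inverse letters act inversely,
    and an action that is trivial on the relators is trivial on their normal
    closure. The action may be defined on a larger type than the invariant set
    [I] on which it is an action. *)
Section Action.
Variables (T : Type) (I : T -> Prop) (f : A * bool -> T -> T).
Hypothesis fI : forall x t, I t -> I (f x t).
Hypothesis fV : forall x t, I t -> f (letter_inv x) (f x t) = t.

Definition act_word w t := foldr f t w.

Lemma act_word_cat u v t : act_word (u ++ v) t = act_word u (act_word v t).
Proof. exact: foldr_cat. Qed.

Lemma act_word_inv w t : I t -> I (act_word w t).
Proof. by move=> It; elim: w => //= x w; apply: fI. Qed.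

Lemma act_push x w t : I t -> act_word (push x w) t = f x (act_word w t).
Proof.
move=> It; case: w => [|y w] //=; case: asboolP => //= ->.
by rewrite -{1}[x]letter_invK fV //; apply: act_word_inv.
Qed.

Lemma act_word_mul u v t :
  I t -> act_word (word_mul u v) t = act_word u (act_word v t).
Proof. by move=> It; elim: u => //= x u IH; rewrite act_push // IH. Qed.

Lemma act_fgM (x y : free_group A) t :
  I t -> act_word (x * y)%g t = act_word x (act_word y t).
Proof. exact: act_word_mul. Qed.

Lemma act_fgV (x : free_group A) t :
  I t -> act_word (x^-1)%g (act_word x t) = t.
Proof. by move=> It; rewrite -act_fgM // mulVg. Qed.

Lemma act_fgw w t : I t -> act_word (fgw w) t = act_word w t.
Proof. exact: act_word_mul. Qed.

Lemma act_normal_closure S :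
  (forall s : free_group A, S s -> forall t, I t -> act_word s t = t) ->
  forall x : free_group A, normal_closure S x ->
  forall t, I t -> act_word x t = t.
Proof.
move=> Sact x nx.
apply: (nx [set y : free_group A | forall t, I t -> act_word y t = t]) => //.
split=> [t|y z Ny Nz t It|y z Ny t It] //.
  have Itz : I (act_word (z^-1)%g t) by apply: act_word_inv.
  by rewrite act_fgM // Ny // -{1}[t]Nz // act_fgV.
have Iz : I (act_word z t) by apply: act_word_inv.
by rewrite conjgE act_fgM // act_fgM // Ny // act_fgV.
Qed.

Lemma act_pw S :
  (forall s : free_group A, S s -> forall t, I t -> act_word s t = t) ->
  forall u v, pw S u = pw S v -> forall t, I t -> act_word u t = act_word v t.
Proof.
move=> Sact u v /pw_eqP uv t It.
have Iv : I (act_word v t) by apply: act_word_inv.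
rewrite -(act_normal_closure Sact uv Iv) act_fgM // -(act_fgw v It) act_fgV //.
by rewrite act_fgw.
Qed.

End Action.

End Words.

Arguments word_span {A S} D.

Section MapWord.
Variables (A B : Type).

Definition word_map (f : A -> B) (w : word A) : word B :=
  [seq (f x.1, x.2) | x <- w].

Definition word_subst (f : A -> word B) (w : word A) : word B :=
  flatten [seq if x.2 then word_inv (f x.1) else f x.1 | x <- w].

Lemma word_map_cat f u v : word_map f (u ++ v) = word_map f u ++ word_map f v.
Proof. exact: map_cat. Qed.

Lemma word_subst_cons f x w : word_subst f (x :: w) =
  (if x.2 then word_inv (f x.1) else f x.1) ++ word_subst f w.
Proof. by []. Qed.

Lemma word_val_map (G : groupType) (gen : B -> G) f w :
  word_val gen (word_map f w) = word_val (gen \o f) w.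
Proof. by rewrite /word_val big_map. Qed.

Lemma word_val_subst (G : groupType) (gen : B -> G) f w :
  word_val gen (word_subst f w) = word_val (fun a => word_val gen (f a)) w.
Proof.
elim: w => [|x w IH]; first by rewrite !word_val_nil.
rewrite word_subst_cons word_val_cat IH word_valE; congr (_ * _).
by case: x => a []; rewrite /letter_val //= word_val_inv.
Qed.

End MapWord.

(** The normal closure of a computable family of relators is enumerable: its
    elements are the products of conjugates of relators and their inverses. *)
Section EnumerableClosure.
Variables (A : eqType) (eA : encoding A).

Lemma asbool_eqE (x y : A * bool) : `[< x = y >] = (x == y).
Proof. by apply/asboolP/eqP. Qed.

Section CompLetter.
Context {X : Type} {eX : encoding X}.
Implicit Types w : X -> word A.

Lemma comp_letter_inv (x : X -> A * bool) :
  computable x -> computable (fun t => letter_inv (x t)).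
Proof. by move=> cx; exact: comp_pair (comp_fst cx) (comp_negb (comp_snd cx)). Qed.

End CompLetter.

Section CompWord.
Context {X : Type} {eX : encoding X}.
Implicit Types w : X -> word A.

Lemma comp_word_inv w : computable w -> computable (fun t => word_inv (w t)).
Proof.
move=> cw; apply/comp_rev/(comp_map (g := fun _ => @letter_inv A)) => //.
exact: comp_letter_inv (comp_snd comp_id).
Qed.

Lemma comp_push (x : X -> A * bool) w :
  computable x -> computable w -> computable (fun t => push (x t) (w t)).
Proof.
move=> cx cw; apply: (@computable_eq _ _ _ _ (fun t =>
  if w t is y :: s then if y == letter_inv (x t) then s else x t :: w t
  else [:: x t])); last first.
  by move=> t; rewrite /push; case: (w t) => // y s; rewrite asbool_eqE.
apply: (comp_case (h := fun t y s =>
  if y == letter_inv (x t) then s else x t :: w t)) => //; last first.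
  by apply: comp_cons => //; apply: comp_const.
have cf (Y : Type) (eY : encoding Y) (g : X -> Y) : computable g ->
    computable (fun p : X * ((A * bool) * word A) => g p.1).
  by move=> cg; apply: comp_comp cg (comp_fst comp_id).
apply: comp_if; last exact: comp_cons (cf _ _ _ cx) (cf _ _ _ cw).
  apply: comp_eq; first exact: comp_fst (comp_snd comp_id).
  exact: cf (comp_letter_inv cx).
exact: comp_snd (comp_snd comp_id).
Qed.

End CompWord.

Lemma comp_red X (eX : encoding X) (w : X -> word A) :
  computable w -> computable (fun t => fgw (w t) : word A).
Proof.
move=> cw; apply: (comp_foldr (g := fun _ => @push A) (i := fun=> [::])) => //.
  by apply: comp_push; [exact: comp_fst (comp_snd comp_id)
                       |exact: comp_snd (comp_snd comp_id)].
exact: comp_const.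
Qed.

Lemma comp_word_over X (eX : encoding X) (D : A -> bool) (w : X -> word A) :
  computable D -> computable w -> computable (fun t => word_over D (w t)).
Proof.
move=> cD cw; apply: (comp_all (p := fun _ x => D x.1)) => //.
exact: comp_comp cD (comp_fst (comp_snd comp_id)).
Qed.

Variables (I : Type) (eI : encoding I) (rel : I -> word A).

Definition conj_rel (c : word A * (I * bool)) : word A :=
  c.1 ++ (if c.2.2 then word_inv (rel c.2.1) else rel c.2.1) ++ word_inv c.1.

Lemma fgw_conj_rel c : fgw (conj_rel c) =
  (if c.2.2 then (fgw (rel c.2.1))^-1 else fgw (rel c.2.1)) ^ (fgw c.1)^-1.
Proof.
case: c => g [i e]; rewrite /conj_rel conjgE invgK !fgw_cat fgw_inv /=.
by case: e; rewrite ?fgw_inv.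
Qed.

Definition rel_set : set (free_group A) := [set x | exists i, x = fgw (rel i)].

Lemma normal_closure_cert (x : free_group A) : normal_closure rel_set x <->
  exists c : seq (word A * (I * bool)), x = fgw (flatten (map conj_rel c)).
Proof.
split=> [|[c ->]]; last first.
  apply/pw_eq1P; elim: c => [|c s IH]; first exact: pw_nil.
  rewrite /= pw_cat IH mulg1 /pw fgw_conj_rel quot_mapJ.
  have : pw rel_set (rel c.2.1) = 1 by apply: pw_rel; exists c.2.1.
  by rewrite /pw; case: ifP => _ E; rewrite ?[quot_map _ (fgw (rel _))^-1]quot_mapV
    E ?invg1 conj1g.
pose N := [set x : free_group A |
  exists c : seq (word A * (I * bool)), x = fgw (flatten (map conj_rel c))].
move=> /(_ N); apply=> [|_ [i ->]]; last first.
  by exists [:: ([::], (i, false))]; rewrite /conj_rel /= !cats0.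
split; first by exists [::]; rewrite fgw_nil.
  move=> _ _ [c ->] [d ->].
  exists (c ++ rev [seq (p.1, (p.2.1, ~~ p.2.2)) | p <- d]).
  rewrite map_cat flatten_cat fgw_cat; congr (_ * _).
  elim: d => [|p d IH]; first by rewrite fgw_nil invg1.
  rewrite /= rev_cons map_rcons flatten_rcons (fgw_cat (conj_rel p)).
  rewrite (fgw_cat (flatten _)) -IH invgM; congr (_ * _).
  rewrite !fgw_conj_rel -conjVg /=; case: (p.2.2) => //=.
  by rewrite invgK.
move=> _ y [c ->]; exists [seq (word_inv y ++ p.1, p.2) | p <- c].
elim: c => [|p d IH]; first by rewrite fgw_nil conj1g.
rewrite /= (fgw_cat (conj_rel p)) (fgw_cat (conj_rel _)) conjMg IH.
congr (_ * _).
by rewrite !fgw_conj_rel -conjgM /= fgw_cat fgw_inv fgw_id invgM invgK.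
Qed.

Lemma enum_pw_eq1 : computable rel -> enumerable (fun w => pw rel_set w = 1).
Proof.
move=> cr; apply: (@enum_iff _ _ (fun w => exists c : seq (word A * (I * bool)),
    fgw w == fgw (flatten (map conj_rel c)) :> word A)).
  move=> w; rewrite pw_eq1P normal_closure_cert.
  by split=> -[c E]; exists c; [apply/val_inj/eqP | rewrite E].
apply: enum_ex; apply: enum_dec; apply: comp_eq.
  exact: comp_red (comp_fst comp_id).
apply/comp_red/comp_flatten.
apply: (comp_map (g := fun _ => conj_rel)); last exact: comp_snd comp_id.
have cg : computable (fun p : word A * seq (word A * (I * bool)) *
  (word A * (I * bool)) => p.2.1) by exact: comp_fst (comp_snd comp_id).
have ci : computable (fun p : word A * seq (word A * (I * bool)) *
  (word A * (I * bool)) => rel p.2.2.1).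
  exact: comp_comp cr (comp_fst (comp_snd (comp_snd comp_id))).
apply: comp_cat => //; apply: comp_cat; last exact: comp_word_inv.
apply: comp_if => //; last exact: comp_word_inv.
exact: comp_snd (comp_snd (comp_snd comp_id)).
Qed.

Lemma enum_pw_eq : computable rel ->
  enumerable (fun p : word A * word A => pw rel_set p.1 = pw rel_set p.2).
Proof.
move=> cr; apply: (@enum_iff _ _ (fun p => pw rel_set (p.1 ++ word_inv p.2) = 1)).
  move=> p; rewrite pw_cat pw_inv; split=> [/divg1_eq|->] //.
  by rewrite mulgV.
apply: enum_comp (enum_pw_eq1 cr) _.
exact: comp_cat (comp_fst comp_id) (comp_word_inv (comp_snd comp_id)).
Qed.

End EnumerableClosure.

(** * HNN extensions and Britton's lemma *)

Section HNN.
Variables (B : eqType) (S : set (free_group B)).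
Variables (D : bool -> B -> bool) (sg : bool -> B -> B).
Hypothesis freeD : forall e, free_on S (D e).
Hypothesis sgD : forall e z, D e z -> D (~~ e) (sg e z).
Hypothesis sgK : forall e z, D e z -> sg (~~ e) (sg e z) = z.

Local Notation H := (quotient_group S).
Local Notation span e := (word_span (D e) : set H).

Implicit Types (u v w : word B) (g h : H).

Lemma word_over_sg e u : word_over (D e) u -> word_over (D (~~ e)) (word_map (sg e) u).
Proof. by elim: u => //= x u IH /andP[Dx /IH ->]; rewrite sgD. Qed.

Lemma word_map_sgK e u :
  word_over (D e) u -> word_map (sg (~~ e)) (word_map (sg e) u) = u.
Proof. by elim: u => //= -[z b] u IH /andP[Dz /IH ->] /=; rewrite sgK. Qed.

(** The isomorphism between the associated subgroups, defined through the
    unique reduced word on a basis. *)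
Definition phi e g : H :=
  if pselect (span e g) is left Dg then pw S (word_map (sg e) (s2val (cid2 Dg)))
  else 1.

Lemma phiE e u : word_over (D e) u -> phi e (pw S u) = pw S (word_map (sg e) u).
Proof.
move=> Du; rewrite /phi; case: pselect => [Dg|[]]; last by exists u.
case: cid2 => v Dv /= /(free_on_inj (@freeD e) Du Dv) uv.
by rewrite !pw_word_val !word_val_map; apply: word_val_eq.
Qed.

Lemma phi_span e g : span e g -> span (~~ e) (phi e g).
Proof.
by move=> [u Du ->]; rewrite phiE //; exists (word_map (sg e) u) => //;
  apply: word_over_sg.
Qed.

Lemma phiM e g h : span e g -> span e h -> phi e (g * h) = phi e g * phi e h.
Proof.
move=> [u Du ->] [v Dv ->].
by rewrite -pw_cat !phiE ?word_over_cat ?Du // word_map_cat pw_cat.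
Qed.

Lemma phiK e g : span e g -> phi (~~ e) (phi e g) = g.
Proof.
by move=> [u Du ->]; rewrite !phiE ?word_map_sgK // word_over_sg.
Qed.

(** Representatives of the right cosets of the associated subgroups. *)
Definition coset_rep e h : H :=
  if `[< span e h >] then 1 else xget 1 [set c | span e (h / c)].

Lemma span_coset_rep e h : span e (h / coset_rep e h).
Proof.
rewrite /coset_rep; case: asboolP => [|_]; first by rewrite invg1 mulg1.
case: xgetP => [c _ //|/(_ h)] []; rewrite /= mulgV; exact: word_span1.
Qed.

Lemma coset_repM e g h : span e g -> coset_rep e (g * h) = coset_rep e h.
Proof.
move=> Dg; have Dgh c : span e (g * h * c) <-> span e (h * c).
  rewrite -mulgA; split=> [Dghc|]; last exact: word_spanM.
  by rewrite -[h * c](mulKg g); apply: word_spanM => //; apply: word_spanV.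
rewrite /coset_rep; have [E1 E2] : (span e (g * h) = span e h) /\
    ([set c | span e (g * h / c)] = [set c | span e (h / c)]).
  split; first by apply/propext; have := Dgh 1; rewrite !mulg1.
  by apply/seteqP; split=> c; rewrite /= Dgh.
by rewrite E1 E2.
Qed.

Lemma coset_rep_eq1 e h : coset_rep e h = 1 <-> span e h.
Proof.
split=> [E|Dh]; last by rewrite /coset_rep asboolT.
by have := span_coset_rep e h; rewrite E invg1 mulg1.
Qed.

Lemma coset_repK e h : coset_rep e (coset_rep e h) = coset_rep e h.
Proof.
rewrite -{1}(coset_repM (coset_rep e h) (span_coset_rep e h)).
by rewrite mulgVK.
Qed.

(** A normal form [(h, [:: (e1, c1); ...])] stands for
    [h x^e1 c1 x^e2 c2 ...], with coset representatives [ci] and without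
    cancellation [x^e 1 x^-e]. *)
Definition nform : Type := (H * seq (bool * H))%type.

Fixpoint is_nf (l : seq (bool * H)) : Prop :=
  if l is p :: s then
    [/\ coset_rep p.1 p.2 = p.2, (if s is q :: _ then p.2 = 1 -> q.1 = p.1 else True)
      & is_nf s]
  else True.

(** Multiplication by [x^e] on the left: the part of the first component that
    lies in the associated subgroup is moved across [x^e], and the rest of it is
    recorded unless [x^e] cancels against the next stable letter. *)
Definition stable_act e (t : nform) : nform :=
  let c := coset_rep e t.1 in
  let u := phi e (t.1 / c) in
  if t.2 is q :: s then
    if (c == 1) && (q.1 != e) then (u * q.2, s) else (u, (e, c) :: t.2)
  else (u, [:: (e, c)]).

Lemma stable_act_nf e t : is_nf t.2 -> is_nf (stable_act e t).2.
Proof.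
case: t => h [|[e' c'] s] /=; first by rewrite coset_repK.
case=> cK c1 ns; rewrite /stable_act /=; case: ifP => //= /negbT; rewrite negb_and negbK => E.
split=> //; first by rewrite coset_repK.
by move=> c1'; move: E; rewrite c1' eqxx /= => /eqP.
Qed.

Lemma stable_actK e t : is_nf t.2 -> stable_act (~~ e) (stable_act e t) = t.
Proof.
have push_case (h : H) l : stable_act (~~ e)
    (phi e (h / coset_rep e h), (e, coset_rep e h) :: l) = (h, l).
  have Dc := span_coset_rep e h; have /phi_span Dp := Dc.
  rewrite /stable_act /= ((coset_rep_eq1 _ _).2 Dp) eqxx /=.
  have -> : e != ~~ e by case: (e).
  by rewrite invg1 mulg1 phiK // mulgVK.
case: t => h [|[e' c'] s] /=; first by rewrite push_case.
case=> cK c1 ns; rewrite [stable_act e _]/stable_act /=.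
case: ifP => /= [/andP[/eqP Dh ne]|_]; last exact: push_case.
have ee : e' = ~~ e by case: (e) (e') ne => [] [].
rewrite ee in cK c1 *; have Dh' := (coset_rep_eq1 _ _).1 Dh.
rewrite Dh invg1 mulg1 /stable_act /= (coset_repM _ (phi_span Dh')) cK.
rewrite mulgK phiK //; case: s c1 ns => // -[e2 c2] s c1 ns /=.
by case: eqP => //= /c1 /= ->; rewrite eqxx.
Qed.

(** This is the relation [x u x^-1 = sg u], for the action. *)
Lemma stable_act_span e u t : word_over (D e) u ->
  stable_act e (pw S u * t.1, t.2) =
  (pw S (word_map (sg e) u) * (stable_act e t).1, (stable_act e t).2).
Proof.
move=> Du; have Dg : span e (pw S u) by exists u.
rewrite /stable_act /= coset_repM // -mulgA.
rewrite (phiM Dg (span_coset_rep _ _)) phiE //; case: (t.2) => [|q s] //=.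
by case: ifP => //= _; rewrite mulgA.
Qed.

Definition hnn_act (x : option B * bool) (t : nform) : nform :=
  if x.1 is Some z then (pw S [:: (z, x.2)] * t.1, t.2) else stable_act x.2 t.

Definition base_word u : word (option B) := word_map Some u.
Definition stable (e : bool) : word (option B) := [:: (None, e)].

(** The relators of the base, and [x z x^-1 = sg z] for [z] in [D false]. *)
Definition hnn_rel : set (free_group (option B)) :=
  [set y | (exists2 s : free_group B, S s & y = fgw (base_word s)) \/
    exists2 z, D false z & y = fgw (stable false ++ base_word [:: (z, false)] ++
      stable true ++ base_word [:: (sg false z, true)])].

Lemma hnn_act_nf x t : is_nf t.2 -> is_nf (hnn_act x t).2.
Proof. by case: x => [[z|] e] //; apply: stable_act_nf. Qed.

Lemma hnn_actV x t : is_nf t.2 -> hnn_act (letter_inv x) (hnn_act x t) = t.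
Proof.
case: x t => [[z|] e] [h l] nl; last exact: stable_actK.
rewrite /hnn_act /= mulgA -pw_cat -[[:: _] ++ _]/[:: (z, ~~ e); (z, e)].
rewrite (_ : pw S _ = 1) ?mul1g // -(pw_nil S); apply: pw_eq; rewrite fgw_nil.
by rewrite -(fgw_letterV (z, ~~ e)) /letter_inv /= negbK.
Qed.

Lemma act_base_word u t :
  act_word hnn_act (base_word u) t = (pw S u * t.1, t.2).
Proof.
elim: u => [|[z e] u IH]; first by rewrite pw_nil mul1g; case: t.
by rewrite pw_cons -mulgA -[LHS]/(hnn_act (Some z, e) (act_word _ _ _)) IH.
Qed.

Lemma hnn_act_rel (y : free_group (option B)) : hnn_rel y ->
  forall t, is_nf t.2 -> act_word hnn_act y t = t.
Proof.
have aw (w : word (option B)) t : is_nf t.2 -> act_word hnn_act (fgw w) t = act_word hnn_act w t.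
  exact: (act_fgw (I := fun t : nform => is_nf t.2) hnn_act_nf hnn_actV).
move=> [[s Ss ->]|[z Dz ->]] t nt; rewrite aw //.
  rewrite act_base_word pw_rel ?mul1g; first by case: t {nt}.
  by rewrite fgw_id.
rewrite !act_word_cat !act_base_word.
set t1 : nform := (pw S [:: (sg false z, true)] * t.1, t.2).
have nt1 : is_nf (stable_act true t1).2 by apply: stable_act_nf.
rewrite -[act_word _ (stable true) t1]/(stable_act true t1).
rewrite -[act_word _ (stable false) _]/(stable_act false _).
rewrite stable_act_span /=; last by rewrite Dz.
rewrite -[false]/(~~ true) stable_actK // /t1 /= mulgA -pw_cat.
rewrite (_ : pw S _ = 1) ?mul1g -?(pw_nil S); first by case: t {nt t1 nt1}.
by apply: pw_eq; rewrite fgw_nil -(fgw_letterV (sg false z, false)).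
Qed.

Lemma hnn_act_pw (u v : word (option B)) : pw hnn_rel u = pw hnn_rel v ->
  act_word hnn_act u (1, [::]) = act_word hnn_act v (1, [::]).
Proof.
move=> uv; apply: (act_pw (I := fun t : nform => is_nf t.2)) uv _ _ => //.
- exact: hnn_act_nf.
- exact: hnn_actV.
- exact: hnn_act_rel.
Qed.

(** The base acts on normal forms by left multiplications on the first
    component, hence faithfully. *)
Lemma base_word_inj u v :
  pw hnn_rel (base_word u) = pw hnn_rel (base_word v) -> pw S u = pw S v.
Proof. by move=> /hnn_act_pw; rewrite !act_base_word !mulg1 => -[]. Qed.

Lemma base_word_pw u v :
  pw S u = pw S v -> pw hnn_rel (base_word u) = pw hnn_rel (base_word v).
Proof.
move=> uv; rewrite !pw_word_val !word_val_map; apply: (pw_lift _ uv) => s Ss.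
rewrite -(word_val_map _ Some) -pw_word_val; apply: pw_rel.
by left; exists s.
Qed.

Lemma base_word_cat u v : base_word (u ++ v) = base_word u ++ base_word v.
Proof. exact: word_map_cat. Qed.

Lemma base_word_inv u : base_word (word_inv u) = word_inv (base_word u).
Proof. by rewrite /base_word /word_inv /word_map map_rev -!map_comp. Qed.

Lemma stable_conj_letter e z : D e z ->
  pw hnn_rel (stable e) * pw hnn_rel (base_word [:: (z, false)]) =
  pw hnn_rel (base_word [:: (sg e z, false)]) * pw hnn_rel (stable e).
Proof.
have stV : pw hnn_rel (stable true) = (pw hnn_rel (stable false))^-1.
  by rewrite -pw_inv.
have L y : D false y ->
    pw hnn_rel (stable false) * pw hnn_rel (base_word [:: (y, false)]) =
    pw hnn_rel (base_word [:: (sg false y, false)]) * pw hnn_rel (stable false).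
  move=> Dy; have : pw hnn_rel (stable false ++ base_word [:: (y, false)] ++
      stable true ++ base_word [:: (sg false y, true)]) = 1.
    by apply: pw_rel; right; exists y.
  rewrite !pw_cat stV.
  have -> : pw hnn_rel (base_word [:: (sg false y, true)]) =
      (pw hnn_rel (base_word [:: (sg false y, false)]))^-1 by rewrite -pw_inv.
  by rewrite -invgM mulgA => /divg1_eq.
case: e => [Dz|]; last exact: L.
have := L _ (sgD Dz); rewrite (sgK Dz) stV => E.
by apply: (mulgI (pw hnn_rel (stable false))); rewrite mulVKg mulgA E mulgK.
Qed.

Lemma stable_conj e u : word_over (D e) u ->
  pw hnn_rel (stable e) * pw hnn_rel (base_word u) =
  pw hnn_rel (base_word (word_map (sg e) u)) * pw hnn_rel (stable e).
Proof.
elim: u => [|[z b] u IH]; first by rewrite !pw_nil mulg1 mul1g.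
case/andP=> /= Dz /IH {}IH.
have P y v : pw hnn_rel (base_word ((y, b) :: v)) =
    pw hnn_rel [:: (Some y, b)] * pw hnn_rel (base_word v) by exact: pw_cons.
rewrite !P mulgA -[RHS]mulgA -IH mulgA; congr (_ * _).
case: b {P}; last exact: stable_conj_letter.
have V y : pw hnn_rel [:: (Some y, true)] =
   (pw hnn_rel (base_word [:: (y, false)]))^-1 by rewrite -pw_inv.
rewrite !V; apply: (mulIg (pw hnn_rel (base_word [:: (z, false)]))).
by rewrite mulgVK -mulgA stable_conj_letter // mulKg.
Qed.

(** The word [h0 x^e1 h1 x^e2 h2 ...] *)
Definition block_word (h0 : word B) (bl : seq (bool * word B)) : word (option B) :=
  base_word h0 ++ flatten [seq stable p.1 ++ base_word p.2 | p <- bl].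

(** No pinch [x^e h x^-e] with [h] in the associated subgroup. *)
Definition britton_reduced (bl : seq (bool * word B)) : Prop :=
  forall pq, pq \in zip bl (behead bl) ->
    pq.2.1 = pq.1.1 \/ ~ span pq.1.1 (pw S pq.1.2).

Lemma britton_reduced_cons p q s : britton_reduced [:: p, q & s] <->
  (q.1 = p.1 \/ ~ span p.1 (pw S p.2)) /\ britton_reduced (q :: s).
Proof.
split=> [rs|[rpq rs] pq]; last by rewrite inE => /predU1P[-> //|/rs].
split; first by apply: (rs (p, q)); rewrite inE eqxx.
by move=> pq pqs; apply: rs; rewrite inE pqs orbT.
Qed.

(** No cancellation occurs when a reduced word is applied, from right to left,
    to the trivial normal form: the first component is the product of the element
    of the base that was read last and an element of the associated subgroup,
    and the former is outside of the subgroup if the next stable letter could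
    cancel. *)
Lemma block_word_act bl : britton_reduced bl ->
  let t := act_word hnn_act (block_word [::] bl) (1, [::]) in
  if bl is p :: s then
    exists g c l, [/\ t = (g, (p.1, c) :: l), span (~~ p.1) g & size l = size s]
  else t = (1, [::]).
Proof.
rewrite /=; elim: bl => [|p bl IH] // rbl.
rewrite -[block_word _ _]/((stable p.1 ++ base_word p.2) ++ block_word [::] bl).
rewrite -catA !act_word_cat.
rewrite -[act_word _ (stable _) _]/(stable_act p.1 _) act_base_word.
case: bl IH rbl => [_ _|q s IH /britton_reduced_cons[rpq /IH]].
  rewrite /= /stable_act /=; do 3!eexists; split; first by [].
    exact/phi_span/span_coset_rep.
  by [].
move=> [g [c [l [-> Dg sl]]]]; rewrite /stable_act /=.
case: ifP => [/andP[/eqP /coset_rep_eq1 Dpg /= nqp]|_]; last first.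
  do 3!eexists; split; first by []; first exact/phi_span/span_coset_rep.
  by rewrite /= sl.
case: rpq => [E|[]]; first by rewrite E eqxx in nqp.
have E : ~~ q.1 = p.1 by case: (q.1) (p.1) nqp => [] [].
rewrite E in Dg; rewrite -[pw S _](mulgK g).
by apply: word_spanM => //; apply: word_spanV.
Qed.

(** Britton's lemma: the base does not change the length of the trivial normal
    form, whereas every stable letter of a reduced word does. *)
Lemma britton (h0 : word B) bl u : britton_reduced bl ->
  pw hnn_rel (block_word h0 bl) = pw hnn_rel (base_word u) -> bl = [::].
Proof.
move=> /block_word_act rbl /hnn_act_pw.
rewrite -[block_word h0 bl]/(base_word h0 ++ block_word [::] bl).
rewrite act_word_cat !act_base_word.
case: bl rbl => // p s [g [c [l [-> _ _]]]] [] _ //.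
Qed.

(** Pinches are removed from right to left, as the letters are read. *)
Lemma britton_ex (v : word (option B)) : exists (h0 : word B) bl,
  britton_reduced bl /\ pw hnn_rel v = pw hnn_rel (block_word h0 bl).
Proof.
elim: v => [|[[z|] e] v [h0 [bl [rbl E]]]].
- by exists [::], [::].
- exists ((z, e) :: h0), bl; split=> //; rewrite pw_cons E -pw_cat.
  by [].
have Ecat l : block_word h0 l = base_word h0 ++ block_word [::] l by [].
have keep : (if bl is q :: _ then q.1 = e \/ ~ span e (pw S h0) else True) ->
    exists (h0 : word B) bl, britton_reduced bl /\
    pw hnn_rel ((None, e) :: v) = pw hnn_rel (block_word h0 bl).
  move=> K; exists [::], ((e, h0) :: bl); split; last first.
    by rewrite pw_cons E -pw_cat.
  by case: bl rbl K {E} => // q s rbl K; apply/britton_reduced_cons.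
case: bl rbl E keep => [|q s] rbl E keep; first exact: keep.
case: (pselect (q.1 = e)) => [qe|nqe]; first by apply: keep; left.
case: (pselect (span e (pw S h0))) => [[u Du hu]|?]; last by apply: keep; right.
exists (word_map (sg e) u ++ q.2), s; split.
  case: s rbl {E keep} => // q' s /britton_reduced_cons[] //.
have qe : q.1 = ~~ e by case: (q.1) (e) nqe => [] [].
rewrite pw_cons E.
rewrite -[block_word h0 _]/(base_word h0 ++ (stable q.1 ++ base_word q.2) ++ block_word [::] s).
rewrite -[block_word (_ ++ _) _]/(base_word (_ ++ _) ++ block_word [::] s).
rewrite base_word_cat !pw_cat (base_word_pw hu) qe mulgA.
rewrite -[[:: (None, e)]]/(stable e) (stable_conj Du) !mulgA.
congr (_ * _ * _ * _).
rewrite -mulgA -pw_cat (_ : pw _ (stable e ++ _) = 1) ?mulg1 //.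
rewrite -(pw_nil hnn_rel); apply: pw_eq.
by rewrite fgw_nil -(fgw_letterV (None, e)).
Qed.

End HNN.

Lemma rel_set1 (A : eqType) (r : free_group A) :
  rel_set (fun _ : bool => r : word A) = [set r].
Proof.
by apply/seteqP; split=> [_ [_ ->]|_ ->] /=; [|exists true]; rewrite fgw_id.
Qed.

Section OneRelatorEnum.
Variables (A : eqType) (eA : encoding A) (r : free_group A).

Lemma enum_one_relator :
  enumerable (fun p : word A * word A => pw [set r] p.1 = pw [set r] p.2).
Proof.
have cr : computable (fun _ : bool => r : word A) by exact: comp_const.
by have := enum_pw_eq cr; rewrite rel_set1.
Qed.

(** Membership in a free Magnus subgroup controls membership in its subgroups
    generated by subsets of the basis: it suffices to inspect the reduced word
    on the basis. *)
Lemma enum_not_span_sub (D D' : A -> bool) : computable D -> computable D' ->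
  (forall a, D' a -> D a) -> free_on [set r] D ->
  enumerable (fun w => ~ word_span D (pw [set r] w)) ->
  enumerable (fun w => ~ word_span D' (pw [set r] w)).
Proof.
move=> cD cD' D'D fD eD; apply: (@enum_iff _ _ (fun w =>
  ~ word_span D (pw [set r] w) \/
  exists u, (word_over D u && ~~ word_over D' (fgw u)) /\
    pw [set r] u = pw [set r] w)).
  move=> w; split=> [[nD|[u [/andP[Du nu] uw]]] [v D'v E]|nD'].
  - by apply: nD; exists v => //; apply: sub_all D'v => x /D'D.
  - have Dv : word_over D v by apply: sub_all D'v => x /D'D.
    have /= uv := free_on_inj fD Du Dv (etrans uw E).
    by rewrite uv (word_over_fgw D'v) in nu.
  have [[u Du E]|] := pselect (word_span D (pw [set r] w)); [right|by left].
  exists u; split=> //; rewrite Du; apply/negP => D'u.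
  by apply: nD'; exists (fgw u) => //; rewrite pw_fgw.
apply: enum_or => //; apply: enum_ex; apply: enum_and.
  apply: enum_dec; have cu : computable (fun z : (word A * word A)%type => z.2) by exact: comp_snd comp_id.
  apply: comp_andb; first exact: comp_word_over.
  by apply/comp_negb/comp_word_over => //; apply: comp_red.
apply: (enum_comp (f := fun p : word A * word A => (p.2, p.1)) enum_one_relator).
by apply: comp_pair; [exact: comp_snd comp_id | exact: comp_fst comp_id].
Qed.

End OneRelatorEnum.

Section HNNEnum.
Variables (B : eqType) (eB : encoding B) (r : free_group B).
Variables (D : bool -> B -> bool) (sg : bool -> B -> B).
Hypothesis freeD : forall e, free_on [set r] (D e).
Hypothesis sgD : forall e z, D e z -> D (~~ e) (sg e z).
Hypothesis sgK : forall e z, D e z -> sg (~~ e) (sg e z) = z.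
Hypothesis compD : computable (D false).
Hypothesis compsg : computable (sg false).
Hypothesis enumD :
  forall e, enumerable (fun w => ~ word_span (D e) (pw [set r] w)).

Local Notation hrel := (hnn_rel [set r] D sg).

(** The relators of the extension as a computable family; the relator of the
    base is repeated at the letters outside of the associated subgroup. *)
Definition hnn_family (i : option B) : word (option B) :=
  if i is Some z then
    if D false z then stable B false ++ base_word [:: (z, false)] ++
      stable B true ++ base_word [:: (sg false z, true)]
    else base_word r
  else base_word r.

Lemma hnn_family_set : rel_set hnn_family = hrel.
Proof.
apply/seteqP; split=> y.
  case=> -[z|] /= ->; last by left; exists r.
  by case: ifP => Dz; [right; exists z | left; exists r].
case=> [[_ -> ->]|[z Dz ->]]; first by exists None.
by exists (Some z); rewrite /= Dz.
Qed.

Lemma comp_base_word X (eX : encoding X) (u : X -> word B) :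
  computable u -> computable (fun x => base_word (u x)).
Proof.
move=> cu; apply: (comp_map (g := fun _ (x : B * bool) => (Some x.1, x.2))) => //.
have cs : computable (fun z : (X * (B * bool))%type => z.2) by exact: comp_snd comp_id.
by apply: comp_pair; [apply: comp_Some; exact: comp_fst | exact: comp_snd].
Qed.

Lemma comp_hnn_family : computable hnn_family.
Proof.
have cr (X : Type) (eX : encoding X) :
  computable (fun _ : X => base_word r) by exact: comp_const.
apply: (comp_option (h := fun _ z => if D false z then
  stable B false ++ base_word [:: (z, false)] ++
  stable B true ++ base_word [:: (sg false z, true)] else base_word r)) => //.
  have cs : computable (fun z : (option B * B)%type => z.2) by exact: comp_snd comp_id.
  apply: comp_if => //; first exact: comp_comp compD cs.
  have c1 (f : option B * B -> B) b :
      computable f -> computable (fun x => base_word [:: (f x, b)]).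
    move=> cf; apply/comp_base_word/comp_cons; last exact: comp_const.
    by apply: comp_pair => //; apply: comp_const.
  apply: comp_cat; first exact: comp_const.
  apply: comp_cat; first exact: c1.
  apply: comp_cat; first exact: comp_const.
  by apply: c1; apply: comp_comp compsg cs.
exact: comp_id.
Qed.

Lemma comp_block_word X (eX : encoding X) (h : X -> word B)
    (bl : X -> seq (bool * word B)) :
  computable h -> computable bl -> computable (fun x => block_word (h x) (bl x)).
Proof.
move=> ch cbl; apply: comp_cat; first exact: comp_base_word.
apply/comp_flatten/(comp_map (g := fun _ p => stable B p.1 ++ base_word p.2)) => //.
have cs : computable (fun z : (X * (bool * word B))%type => z.2) by exact: comp_snd comp_id.
apply: comp_cat; last exact/comp_base_word/comp_snd.
apply: comp_cons; last exact: comp_const.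
by apply: comp_pair; [exact: comp_const | exact: comp_fst].
Qed.

Lemma enum_britton_reduced : enumerable (britton_reduced [set r] D).
Proof.
pose Y := ((bool * word B) * (bool * word B))%type.
apply: (enum_all (Q := fun _ pq => pq.2.1 = pq.1.1 \/
   ~ word_span (D pq.1.1) (pw [set r] pq.1.2)) (l := fun bl => zip bl (behead bl))).
  have cs : computable (fun z : (seq (bool * word B) * Y)%type => z.2) by exact: comp_snd comp_id.
  apply: (@enum_iff _ _ (fun p : seq (bool * word B) * Y =>
    (p.2.2.1 == p.2.1.1) \/
    ((p.2.1.1 /\ ~ word_span (D true) (pw [set r] p.2.1.2)) \/
     (~~ p.2.1.1 /\ ~ word_span (D false) (pw [set r] p.2.1.2))))).
    move=> [s [[e u] [b v]]]; split=> /=.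
      case=> [/eqP ->|[[De nD]|[De nD]]]; first by left.
        by right; move: De nD; case: e.
      by right; move: De nD; case: e.
    case=> [->|nD]; first by left.
    by right; case: e nD => nD; [left|right].
  apply: enum_or; first by apply/enum_dec/comp_eq; [exact/comp_fst/comp_snd
                                                   |exact/comp_fst/comp_fst].
  have ce : computable (fun p : seq (bool * word B) * Y => p.2.1.1).
    exact/comp_fst/comp_fst.
  have cu : computable (fun p : seq (bool * word B) * Y => p.2.1.2).
    exact/comp_snd/comp_fst.
  apply: enum_or; apply: enum_and.
  - exact: enum_dec.
  - exact: enum_comp (enumD true) cu.
  - exact/enum_dec/comp_negb.
  - exact: enum_comp (enumD false) cu.
pose E := (bool * word B)%type.
have -> : (fun bl : seq E => zip bl (behead bl)) = (fun bl : seq E =>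
   (foldr (fun p (a : option E * seq (E * E)) =>
     (Some p, if a.1 is Some q then (p, q) :: a.2 else a.2)) (None, [::]) bl).2).
  apply/funext => bl.
  suff -> : foldr (fun p (a : option E * seq (E * E)) =>
     (Some p, if a.1 is Some q then (p, q) :: a.2 else a.2)) (None, [::]) bl =
     (ohead bl, zip bl (behead bl)) by [].
  by elim: bl => //= p bl ->; case: bl.
apply: comp_snd; apply: (comp_foldr (g := fun (_ : seq E) p
  (a : option E * seq (E * E)) => (Some p, if a.1 is Some q then (p, q) :: a.2 else a.2))
  (i := fun=> (None, [::]))); [|exact: comp_const|exact: comp_id].
pose Z := (seq E * (E * (option E * seq (E * E))))%type.
have c1 : computable (fun z : Z => z.2.1) by exact: comp_fst (comp_snd comp_id).
have c2 : computable (fun z : Z => z.2.2.1).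
  exact: comp_fst (comp_snd (comp_snd comp_id)).
have c3 : computable (fun z : Z => z.2.2.2).
  exact: comp_snd (comp_snd (comp_snd comp_id)).
apply: comp_pair; first exact: comp_Some.
apply: (comp_option (h := fun (z : Z) q => (z.2.1, q) :: z.2.2.2)) => //.
apply: comp_cons; last exact: comp_comp c3 (comp_fst comp_id).
by apply: comp_pair; [exact: comp_comp c1 (comp_fst comp_id)|exact: comp_snd comp_id].
Qed.

(** Non-membership in a subgroup of the base is enumerable: a certificate is a
    Britton reduced form that has a stable letter or else lies in the base and
    outside the subgroup. *)
Lemma enum_not_base (D' : B -> bool) :
  enumerable (fun w => ~ word_span D' (pw [set r] w)) ->
  enumerable (fun v => ~ exists2 u, word_over D' u & pw hrel v = pw hrel (base_word u)).
Proof.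
move=> eD'; apply: (@enum_iff _ _ (fun v => exists hb : word B * seq (bool * word B),
   (pw hrel v = pw hrel (block_word hb.1 hb.2) /\ britton_reduced [set r] D hb.2) /\
   (hb.2 != [::] \/ ~ word_span D' (pw [set r] hb.1)))).
  move=> v; split=> [[[h bl] /= [[E rbl] nD']] [u Du vu]|nD'].
    have bl0 := britton freeD sgD sgK rbl (etrans (esym E) vu).
    case: nD' => [|[]]; first by rewrite bl0.
    exists u => //; apply: (base_word_inj freeD sgD sgK).
    by rewrite -vu E bl0 /block_word cats0.
  have [h [bl [rbl E]]] := britton_ex [set r] sgD sgK v.
  exists (h, bl); split=> //=; case: bl rbl E => [|p s] rbl E; [right|by left].
  move=> [u Du hu]; apply: nD'; exists u => //.
  by rewrite E /block_word cats0; apply: base_word_pw.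
pose Z := (word (option B) * (word B * seq (bool * word B)))%type.
have cs : computable (fun z : Z => z.2) by exact: comp_snd comp_id.
have c1 : computable (fun z : Z => z.2.1) by exact: comp_fst.
have c2 : computable (fun z : Z => z.2.2) by exact: comp_snd.
apply: enum_ex; apply: enum_and.
  apply: enum_and; last exact: enum_comp enum_britton_reduced c2.
  have := enum_pw_eq comp_hnn_family; rewrite hnn_family_set => ee.
  apply: (enum_comp ee (f := fun z : Z => (z.1, block_word z.2.1 z.2.2))).
  by apply: comp_pair; [exact: comp_fst comp_id | exact: comp_block_word].
apply: enum_or; last exact: enum_comp eD' c1.
apply/enum_dec/comp_negb/comp_eq => //; exact: comp_const.
Qed.

End HNNEnum.

(** * Integer powers in a group *)

Section IntPower.
Variables (G : groupType) (x : G).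

Definition zpow (i : int) : G :=
  match i with Posz n => x ^+ n | Negz n => x ^- n.+1 end.

Lemma zpowS (i : int) : zpow (i + 1)%R = zpow i * x.
Proof.
case: i => n; first by rewrite -[(_ + _)%R]/(Posz (n + 1)) addn1 /= expgSr.
case: n => [|n]; first by rewrite /= expg1 mulVg.
rewrite (_ : (Negz n.+1 + 1)%R = Negz n) /=; last by lia.
by rewrite [x ^+ n.+2]expgS invgM mulgVK.
Qed.

Lemma zpowP (i : int) : zpow (i - 1)%R = zpow i / x.
Proof. by rewrite -{2}[i](GRing.subrK 1%R) zpowS mulgK. Qed.

Lemma zpowD (i j : int) : zpow (i + j)%R = zpow i * zpow j.
Proof.
elim/int_rect: j => [|n IH|n IH]; first by rewrite GRing.addr0 mulg1.
  by rewrite -addn1 PoszD GRing.addrA !zpowS IH mulgA.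
by rewrite -addn1 PoszD GRing.opprD GRing.addrA !zpowP IH mulgA.
Qed.

Lemma zpow0 : zpow 0 = 1. Proof. by []. Qed.
Lemma zpow1 : zpow 1 = x. Proof. exact: expg1. Qed.

Lemma zpowN (i : int) : zpow (- i)%R = (zpow i)^-1.
Proof. by apply: (mulgI (zpow i)); rewrite -zpowD GRing.subrr mulgV. Qed.

Definition zword (A : Type) (a : A) (i : int) : word A := nseq `|i| (a, (i < 0)%R).

End IntPower.

Lemma word_val_zword (G : groupType) (A : Type) (gen : A -> G) a i :
  word_val gen (zword a i) = zpow (gen a) i.
Proof.
have E n e : word_val gen (nseq n (a, e)) = letter_val gen (a, e) ^+ n.
  elim: n => [|n IH]; first exact: word_val_nil.
  by rewrite /= word_valE IH expgS.
by case: i => n; rewrite /zword E /letter_val //= expVgn.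
Qed.

(** * Elimination of a letter *)

Lemma reduced_catr (A : Type) (u v : word A) : reduced (u ++ v) -> reduced v.
Proof. by move=> /cat_sorted2[]. Qed.

Lemma reduced_catl (A : Type) (u v : word A) : reduced (u ++ v) -> reduced u.
Proof. by move=> /cat_sorted2[]. Qed.

Lemma reduced2 (A : eqType) (x y : A * bool) (w : word A) :
  reduced (x :: y :: w) = (y != letter_inv x) && reduced (y :: w).
Proof. by rewrite /reduced /= asbool_neg asbool_eqE. Qed.

Section Elimination.
Variables (A : eqType) (s b : A) (al : nat) (ga : int).
Hypothesis al_gt0 : 0 < al.
Implicit Types (w u v : word A) (i j k : int).

(** The weights are the exponents of the stable letter [x] in the images of the
    letters; [ga] will be such that the relator has weight 0. *)
Definition wt (z : A) : int :=
  if z == b then Posz al else if z == s then ga else 0%R.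

Definition letter_wt (x : A * bool) : int := if x.2 then (- wt x.1)%R else wt x.1.

Definition word_wt w : int := foldr (fun x i => (letter_wt x + i)%R) 0%R w.

Lemma word_wt_cons x w : word_wt (x :: w) = (letter_wt x + word_wt w)%R.
Proof. by []. Qed.

Lemma word_wt_cat u v : word_wt (u ++ v) = (word_wt u + word_wt v)%R.
Proof. by elim: u => [|x u IH] /=; rewrite ?GRing.add0r // IH GRing.addrA. Qed.

Lemma word_wt_run n e : word_wt (nseq n (b, e)) =
  (if e then - Posz (al * n)%N else Posz (al * n)%N)%R.
Proof.
case: e; elim: n => [|n IH]; rewrite ?muln0 //=.
  by rewrite IH /letter_wt /wt eqxx mulnS /=; lia.
by rewrite IH /letter_wt /wt eqxx mulnS /=; lia.
Qed.

(** The word obtained by erasing the letters [b] and by giving each other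
    letter the weight of the prefix before it (after it, for an inverse letter)
    as an index. *)
Fixpoint elim_word i w : word (A * int) :=
  if w is x :: w' then
    let k := (i + letter_wt x)%R in
    if x.1 == b then elim_word k w'
    else ((x.1, if x.2 then k else i), x.2) :: elim_word k w'
  else [::].

Lemma elim_word_cons i x w : x.1 != b ->
  elim_word i (x :: w) =
  ((x.1, if x.2 then (i + letter_wt x)%R else i), x.2) ::
    elim_word (i + letter_wt x)%R w.
Proof. by move=> /= /negbTE ->. Qed.

Lemma elim_word_cat i u v :
  elim_word i (u ++ v) = elim_word i u ++ elim_word (i + word_wt u)%R v.
Proof.
elim: u i => [|x u IH] i /=; first by rewrite GRing.addr0.
by rewrite IH GRing.addrA; case: ifP.
Qed.

Lemma elim_word_shift d i w :
  elim_word (i + d)%R w = word_map (fun z => (z.1, (z.2 + d)%R)) (elim_word i w).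
Proof.
elim: w i => //= x w IH i; rewrite GRing.addrAC IH.
by case: ifP => //= _; case: (x.2).
Qed.

Lemma size_elim_word i w : size (elim_word i w) = count (fun x => x.1 != b) w.
Proof. by elim: w i => //= x w IH i; case: eqP => /= _; rewrite IH. Qed.

Lemma elim_word_run i n e u :
  elim_word i (nseq n (b, e) ++ u) = elim_word (i + word_wt (nseq n (b, e)))%R u.
Proof.
elim: n i => [|n IH] i /=; first by rewrite GRing.addr0.
by rewrite eqxx IH -GRing.addrA.
Qed.

(** The powers of [b] between the other letters are what the elimination turns
    into differences of indices. *)
Lemma run_split w : reduced w -> exists n e u,
  w = nseq n (b, e) ++ u /\ (if u is x :: _ then x.1 != b else true).
Proof.
elim: w => [|x w IH] rw; first by exists 0, false, [::].
have [xb|xb] := eqVneq x.1 b; last by exists 0, false, (x :: w).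
have [n [e [u [E hu]]]] := IH (reduced_behead rw).
case: n E => [|n] E.
  by exists 1%N, x.2, u; split; rewrite // E /= -xb -surjective_pairing.
exists n.+2, e, u; split=> //; rewrite E; congr (_ :: _).
move: rw; rewrite E reduced2 => /andP[+ _]; rewrite [x]surjective_pairing xb.
by rewrite /letter_inv /=; case: (x.2) (e) => [] []; rewrite ?eqxx.
Qed.

(** Between a letter and an inverse of it there is a nontrivial power of [b],
    which separates their indices. *)
Lemma elim_word_reduced i w : reduced w -> reduced (elim_word i w).
Proof.
have [n] := ubnP (size w); elim: n => // n IH in i w *.
case: w => [|x w] // sw rw; have rw' := reduced_behead rw.
rewrite [elim_word i _]/=.
have [xb|xb] := eqVneq; first exact: IH.
have [m [e [u [E hu]]]] := run_split rw'.
have ru : reduced u by move: rw'; rewrite E; apply: reduced_catr.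
have su : size u < n.
  by move: sw; rewrite E /= size_cat size_nseq; lia.
rewrite E elim_word_run.
have := IH (i + letter_wt x + word_wt (nseq m (b, e)))%R u su ru.
case: u E hu {ru su IH} => [|y u] E // yb; rewrite elim_word_cons // reduced2 => ->.
rewrite andbT; apply/eqP => -[yx Ej ye]; case: m E Ej => [|m] E; last first.
  rewrite word_wt_run /letter_wt yx ye; case: (x.2) (e) => [] [] /=; nia.
move: rw; rewrite E -[nseq 0 _ ++ _]/(y :: u) reduced2 => /andP[/eqP[]].
by rewrite [y]surjective_pairing yx ye.
Qed.

Lemma elim_word_nil i w :
  reduced w -> elim_word i w = [::] -> word_wt w = 0%R -> w = [::].
Proof.
move=> /run_split[n [e [[|x u] [-> hu]]]]; rewrite elim_word_run /=; last first.
  by rewrite (negbTE hu).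
rewrite cats0 word_wt_run => _; case: n => // n; case: e; nia.
Qed.

Lemma letter_wt0 x : ga = 0%R -> x.1 != b -> letter_wt x = 0%R.
Proof.
by rewrite /letter_wt /wt => -> /negbTE ->; rewrite !if_same.
Qed.

(** If only [b] has a weight, a maximal power of [b] changes the index of the
    next letter, or the weight of the word at its end. *)
Lemma elim_word_index0 w : ga = 0%R -> reduced w -> word_wt w = 0%R ->
  all (fun x => x.1.2 == 0%R) (elim_word 0%R w) -> all (fun x => x.1 != b) w.
Proof.
move=> ga0; have [n] := ubnP (size w); elim: n => // n IH in w *.
move=> sw rw w0 allw; have [m [e [u [E hu]]]] := run_split rw.
have m0 : m = 0.
  move: w0 allw; rewrite E elim_word_run word_wt_cat word_wt_run.
  case: u hu {E} => [|x u] /= xb; first by case: m => // m; case: e; nia.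
  rewrite (negbTE xb) /= => _ /andP[+ _]; rewrite letter_wt0 // GRing.addr0 if_same.
  by case: m => // m; case: e => /eqP; nia.
rewrite m0 /= in E; rewrite {m m0 e}E in sw rw w0 allw *.
case: u hu sw rw w0 allw => //= x u xb su ru w0; rewrite (negbTE xb) /=.
have x0 := letter_wt0 ga0 xb.
rewrite x0 GRing.addr0 in w0 * => /andP[_ allu]; apply: IH => //.
  exact: reduced_behead ru.
by rewrite GRing.add0r in w0.
Qed.

Lemma elim_word_over (D : A -> bool) i w : word_over D w ->
  word_over (fun z => D z.1 && (z.1 != b)) (elim_word i w).
Proof.
elim: w i => //= x w IH i /andP[Dx Dw].
by case: eqP => xb /=; rewrite ?Dx ?IH // andbT; apply/eqP.
Qed.

Lemma elim_word_const i w : ga = 0%R -> word_over (predC1 b) w ->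
  word_over (fun z => z.2 == i) (elim_word i w) /\ word_wt w = 0%R.
Proof.
move=> ga0; elim: w i => [|x w IH] i //= /andP[xb Dw].
rewrite (negbTE xb) letter_wt0 // GRing.addr0 if_same GRing.add0r /= eqxx.
exact: IH.
Qed.

(** Evaluation of the eliminated word, when [b] is the power [x^al] and the
    letter [a] carries an additional power of [x]. *)
Section Eval.
Variables (K : groupType) (x : K) (g : A -> K) (gi : A * int -> K).

Definition root_gen (a : A) : K := (if a == b then 1 else g a) * zpow x (wt a).

Lemma elim_word_eval i w :
  (forall z e, (z, e) \in elim_word i w ->
    gi z = zpow x z.2 * g z.1 * zpow x (- z.2)%R) ->
  zpow x i * word_val root_gen w =
  word_val gi (elim_word i w) * zpow x (i + word_wt w)%R.
Proof.
elim: w i => [|[z e] w IH] i H.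
  by rewrite !word_val_nil mulg1 mul1g GRing.addr0.
have /= {}IH := IH (i + letter_wt (z, e))%R; rewrite word_valE /=.
move: H; rewrite /= GRing.addrA; case: ifP => /= [/eqP zb|zb] H.
  rewrite -IH // {1}zpowD -mulgA; congr (_ * (_ * _)).
  rewrite /letter_val /root_gen /letter_wt /= zb eqxx mul1g.
  by case: e {IH H}; rewrite ?zpowN.
rewrite word_valE -mulgA -IH; last first.
  by move=> y f yw; apply: (H _ f); rewrite inE yw orbT.
have := H _ e (mem_head _ _); rewrite /letter_val /root_gen /letter_wt /= zb.
case: e {IH H} => /= ->.
  rewrite (zpowN _ (i - wt z)%R) !invgM invgK !mulgA mulgVK.
  by rewrite (zpowD _ i) zpowN.
by rewrite zpowN zpowD !mulgA mulgVK.
Qed.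

End Eval.

End Elimination.

(** * The group of bijections of a type *)

Section Bijections.
Variable T : Type.

Record bij := Bij { fwd : T -> T; bwd : T -> T;
                    fwdK : cancel fwd bwd; bwdK : cancel bwd fwd }.

Lemma bij_eq (f g : bij) : fwd f =1 fwd g -> f = g.
Proof.
case: f g => [f f' fK f'K] [g g' gK g'K] /= /funext fg.
rewrite -{}fg in gK g'K *.
have E : f' = g' by apply/funext => t; rewrite -{1}(g'K t) fK.
rewrite -{}E in gK g'K *.
by rewrite (Prop_irrelevance fK gK) (Prop_irrelevance f'K g'K).
Qed.

HB.instance Definition _ := gen_eqMixin bij.
HB.instance Definition _ := gen_choiceMixin bij.

Definition bij1 : bij := @Bij id id (fun=> erefl) (fun=> erefl).
Definition bijV (f : bij) : bij := Bij (@bwdK f) (@fwdK f).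
Definition bijM (f g : bij) : bij :=
  Bij (can_comp (@fwdK f) (@fwdK g)) (can_comp (@bwdK g) (@bwdK f)).

Lemma bijA : associative bijM. Proof. by move=> f g h; apply: bij_eq. Qed.
Lemma bij1M : left_id bij1 bijM. Proof. by move=> f; apply: bij_eq. Qed.
Lemma bijM1 : right_id bij1 bijM. Proof. by move=> f; apply: bij_eq. Qed.
Lemma bijVM : left_inverse bij1 bijV bijM.
Proof. by move=> f; apply: bij_eq => t /=; rewrite fwdK. Qed.
Lemma bijMV : right_inverse bij1 bijV bijM.
Proof. by move=> f; apply: bij_eq => t /=; rewrite bwdK. Qed.

HB.instance Definition _ := isGroup.Build bij bijA bij1M bijM1 bijVM bijMV.

Lemma fwdM (f g : bij) t : fwd (f * g) t = fwd f (fwd g t).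
Proof. by []. Qed.

Definition stabilizes (X : set T) (f : bij) := forall t, X (fwd f t) <-> X t.

Lemma stabilizes1 X : stabilizes X 1.
Proof. by []. Qed.

Lemma stabilizesM X f g : stabilizes X f -> stabilizes X g -> stabilizes X (f * g).
Proof. by move=> sf sg t; rewrite fwdM sf. Qed.

Lemma stabilizesV X f : stabilizes X f -> stabilizes X f^-1.
Proof. by move=> sf t; rewrite -sf -fwdM mulgV. Qed.

Lemma stabilizes_zpow X f i : stabilizes X f -> stabilizes X (zpow f i).
Proof.
move=> sf; have sX n : stabilizes X (f ^+ n).
  by elim: n => // n IH; rewrite expgS; apply: stabilizesM.
by case: i => n; [apply: sX | apply: stabilizesV; apply: sX].
Qed.

Lemma stabilizes_word X (A : eqType) (gen : A -> bij) (w : word A) :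
  (forall z e, (z, e) \in w -> stabilizes X (gen z)) ->
  stabilizes X (word_val gen w).
Proof.
elim: w => [|[z e] w IH] H; first by rewrite word_val_nil; apply: stabilizes1.
rewrite word_valE; apply: stabilizesM; last first.
  by apply: IH => y f yw; apply: (H y f); rewrite inE yw orbT.
have := H z e (mem_head _ _); rewrite /letter_val /=.
by case: (e) => // ?; apply: stabilizesV.
Qed.

End Bijections.

(** Every element [b] of a group acquires a root of order [m.+1] in a larger
    group: [m.+1] copies of the group are permuted cyclically, with a
    multiplication by [b] after the last one. *)
Section Root.
Variables (G : groupType) (b : G) (m : nat).
Local Notation T := (G * 'I_m.+1)%type.

Definition diag_fun (g : G) (t : T) : T := (g * t.1, t.2).

Lemma diag_funK g : cancel (diag_fun g) (diag_fun g^-1).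
Proof. by case=> h i; rewrite /diag_fun /= mulKg. Qed.

Lemma diag_funVK g : cancel (diag_fun g^-1) (diag_fun g).
Proof. by case=> h i; rewrite /diag_fun /= mulVKg. Qed.

Definition diag (g : G) : bij T := Bij (diag_funK g) (diag_funVK g).

Lemma diagM g h : diag (g * h) = diag g * diag h.
Proof. by apply: bij_eq => t; rewrite /= /diag_fun /= mulgA. Qed.

Lemma diag1 : diag 1 = 1.
Proof. by apply: bij_eq => -[h i]; rewrite /= /diag_fun /= mul1g. Qed.

Lemma diagV g : diag g^-1 = (diag g)^-1.
Proof. by apply: bij_eq. Qed.

Lemma word_val_diag (A : Type) (gen : A -> G) (w : word A) :
  word_val (fun a => diag (gen a)) w = diag (word_val gen w).
Proof.
elim: w => [|[z e] w IH]; first by rewrite !word_val_nil diag1.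
rewrite !word_valE IH diagM; congr (_ * _).
by case: e; rewrite /letter_val //= diagV.
Qed.

Definition root_fun (t : T) : T :=
  if t.2 == m :> nat then (b * t.1, ord0) else (t.1, inord t.2.+1).

Definition root_inv (t : T) : T :=
  if t.2 == 0 :> nat then (b^-1 * t.1, ord_max) else (t.1, inord t.2.-1).

Lemma root_funK : cancel root_fun root_inv.
Proof.
case=> g i; have lti := ltn_ord i; rewrite /root_fun /=.
case: eqP => [im|im]; rewrite /root_inv /=.
  by rewrite mulKg; congr pair; apply: val_inj; rewrite /= im.
rewrite inordK /=; last by lia.
by congr pair; apply: val_inj; rewrite /= inordK; lia.
Qed.

Lemma root_invK : cancel root_inv root_fun.
Proof.
case=> g i; have lti := ltn_ord i; rewrite /root_inv /=.
case: eqP => [i0|i0]; rewrite /root_fun /=.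
  by rewrite eqxx mulVKg; congr pair; apply: val_inj; rewrite /= i0.
rewrite inordK; last by lia.
case: eqP => [|_]; first by lia.
by congr pair; apply: val_inj; rewrite /= inordK; lia.
Qed.

Definition adj_root : bij T := Bij root_funK root_invK.

Lemma root_exp : adj_root ^+ m.+1 = diag b.
Proof.
have E n (g : G) (i : 'I_m.+1) : n <= m.+1 -> fwd (adj_root ^+ n) (g, i) =
    if i + n <= m then (g, inord (i + n)%N) else (b * g, inord (i + n - m.+1)%N).
  elim: n => [|n IH] ltn.
    by rewrite addn0 -ltnS ltn_ord; congr pair; apply: val_inj; rewrite /= inordK.
  rewrite expgS fwdM IH ?(ltnW ltn) //; have lti := ltn_ord i.
  case: ifP => lin; rewrite /= /root_fun /= inordK; try lia.
    case: eqP => /= [Em|nm].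
      rewrite ifF; last by lia.
      by congr pair; apply: val_inj; rewrite /= inordK; lia.
    by rewrite ifT; [congr pair; apply: val_inj; rewrite /= !inordK; lia | lia].
  rewrite ifF; last by lia.
  rewrite ifF; last by lia.
  by congr pair; apply: val_inj; rewrite /= !inordK; lia.
apply: bij_eq => -[g i]; rewrite E // ifF; last by lia.
by rewrite addnK; congr pair; apply: val_inj; rewrite /= inordK.
Qed.

(** Only the passage from the last copy to the first one moves the component in
    the group. *)
Lemma stabilizes_root (X : set G) : (forall g, X (b * g) <-> X g) ->
  stabilizes [set t : T | X t.1] adj_root.
Proof. by move=> Xb [g i] /=; rewrite /root_fun /=; case: ifP => //= _. Qed.

Lemma stabilizes_diag (X : set G) h : (forall g, X (h * g) <-> X g) ->
  stabilizes [set t : T | X t.1] (diag h).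
Proof. by move=> Xh [g i] /=. Qed.

End Root.

(** Groups are multiplicative: the integers are given their addition as a
    product. *)
Definition int_group := int.
HB.instance Definition _ := Choice.on int_group.
HB.instance Definition _ := isGroup.Build int_group
  (@GRing.addrA int) (@GRing.add0r int) (@GRing.addr0 int)
  (@GRing.addNr int) (@GRing.addrN int).

Lemma word_wt_pw (A : eqType) (s b : A) al ga (r : free_group A) (u v : word A) :
  word_wt s b al ga r = 0%R -> pw [set r] u = pw [set r] v ->
  word_wt s b al ga u = word_wt s b al ga v.
Proof.
have E w : word_wt s b al ga w =
    word_val (wt s b al ga : A -> int_group) w :> int_group.
  elim: w => [|x w IH]; first by rewrite word_val_nil.
  rewrite word_valE -IH /= /letter_wt /letter_val.
  by case: (x.2).
rewrite !E => r0; apply: (pw_lift (gen := wt s b al ga : A -> int_group)).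
by move=> _ ->.
Qed.

(** * The HNN extension attached to a pair of letters *)

Section Shift.
Variables (A : eqType) (s : A) (mu M : int).
Local Notation B := (A * int)%type.

(** The indices are shifted by the stable letter, from the letters other than
    [(s, M)] to the letters other than [(s, mu)]; the removal of a second letter
    on each side makes the shift a bijection. *)
Definition assoc_dom (e : bool) (z : B) : bool :=
  if e then (z != (s, mu)) && (z != (s, M + 1)%R)
  else (z != (s, M)) && (z != (s, mu - 1)%R).

Definition shift (e : bool) (z : B) : B :=
  (z.1, if e then z.2 - 1 else z.2 + 1)%R.

Lemma shift_dom e z : assoc_dom e z -> assoc_dom (~~ e) (shift e z).
Proof.
case: z => c i; rewrite /assoc_dom /shift; case: e => /=; rewrite !xpair_eqE;
  case: (c == s) => //=; lia.
Qed.

Lemma shiftK e z : assoc_dom e z -> shift (~~ e) (shift e z) = z.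
Proof. by case: z e => c i [] _; rewrite /shift /=; congr pair; lia. Qed.

End Shift.

Section Step.
Variables (A : eqType) (r : free_group A) (s b : A) (m : nat) (ga : int).
Hypothesis sNb : s != b.
Local Notation al := m.+1.
Local Notation wt := (wt s b al ga).
Local Notation word_wt := (word_wt s b al ga).
Local Notation elim_word := (elim_word s b al ga).
Local Notation root_gen := (root_gen s b al ga).
Hypothesis wt_r : word_wt r = 0%R.

Variables (i0 mu M : int) (r0 : free_group (A * int)).
Local Notation B := (A * int)%type.
Local Notation letters0 := (unzip1 (r0 : word B)).
Hypothesis r0E : r0 = elim_word i0 r :> word _.
Hypothesis s_bounds : forall i, (s, i) \in letters0 -> (mu <= i <= M)%R.
Hypotheses (s_0 : (s, 0%R : int) \in letters0) (s_mu : (s, mu) \in letters0)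
           (s_M : (s, M) \in letters0).
Hypothesis free_r0 : forall a, a \in letters0 -> free_on [set r0] (predC1 a).

Local Notation assoc_dom := (assoc_dom s mu M).
Local Notation shift := (@shift A).

Lemma assoc_dom_free e : free_on [set r0] (assoc_dom e).
Proof.
by case: e; [apply: free_on_sub (free_r0 s_mu)|apply: free_on_sub (free_r0 s_M)]
  => a /andP[].
Qed.

Local Notation hrel := (hnn_rel [set r0] assoc_dom shift).
Local Notation x := (pw hrel (stable B false)).

Definition elt (z : B) := pw hrel (base_word [:: (z, false)]).

Lemma elt_shift z : assoc_dom false z -> elt (shift false z) = x * elt z / x.
Proof.
move=> Dz; apply: (mulIg x); rewrite mulgVK.
by rewrite (stable_conj_letter [set r0] (@shift_dom A s mu M) (@shiftK A s mu M) Dz).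
Qed.

(** The letters for which the stable letter relates all indices to the index 0:
    the indices of [s] may not leave the interval between [mu] and [M]. *)
Definition valid (z : B) : bool := (z.1 != s) || (mu <= z.2 <= M)%R.

Lemma elt_zpow z : valid z -> elt z = zpow x z.2 * elt (z.1, 0%R) * zpow x (- z.2)%R.
Proof.
case: z => c; rewrite /valid /=; have /andP[mu0 M0] := s_bounds s_0.
elim/int_rect => [|n IH|n IH] V; first by rewrite mul1g mulg1.
  have -> : (c, Posz n.+1) = shift false (c, Posz n).
    by rewrite /shift /=; congr pair; lia.
  rewrite elt_shift; last first.
    by rewrite /assoc_dom !xpair_eqE; case: eqP V => //=; lia.
  rewrite IH; last by case: eqP V => //=; lia.
  rewrite (_ : Posz n.+1 = (Posz n + 1)%R); last by lia.
  by rewrite GRing.opprD GRing.addrC zpowD zpow1 zpowP !mulgA.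
have E : elt (c, - Posz n)%R = x * elt (c, - Posz n.+1)%R / x.
  rewrite -elt_shift; first by congr elt; rewrite /shift /=; congr pair; lia.
  by rewrite /assoc_dom !xpair_eqE; case: eqP V => //=; lia.
have -> : elt (c, - Posz n.+1)%R = x^-1 * elt (c, - Posz n)%R * x.
  by rewrite E !mulgA mulVg mul1g mulgVK.
rewrite IH; last by case: eqP V => //=; lia.
rewrite (_ : (- Posz n.+1)%R = (-1 + - Posz n)%R); last by lia.
rewrite GRing.opprD zpowD [zpow x (- -1 - _)%R]zpowD.
rewrite GRing.opprK zpow1 (_ : zpow x (-1)%R = x^-1) // !mulgA.
have C k : zpow x k * x = x * zpow x k.
  by rewrite -zpowS GRing.addrC zpowD zpow1.
by rewrite -[LHS]mulgA C !mulgA.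
Qed.

(** The letter [b] is mapped to [x^al], and another letter [a] to
    [a_0 x^wt(a)]: the weights are what makes the image of [r] a word in the
    letters with indices. *)
Definition Phi (a : A) : word (option B) :=
  (if a == b then [::] else [:: (Some (a, 0%R : int), false)]) ++ zword None (wt a).

Lemma pw_zword i : pw hrel (zword None i) = zpow x i.
Proof.
rewrite pw_word_val word_val_zword; congr zpow.
by rewrite pw_word_val word_val1.
Qed.

Lemma pw_base_elt u : pw hrel (base_word u) = word_val elt u.
Proof.
elim: u => [|[z e] u IH]; first by rewrite pw_nil word_val_nil.
rewrite word_valE -IH -[base_word _]/([:: (Some z, e)] ++ base_word u) pw_cat.
by congr (_ * _); case: e; rewrite /letter_val //= -pw_inv.
Qed.

Lemma pw_Phi w : pw hrel (word_subst Phi w) =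
  word_val (root_gen x (fun a => elt (a, 0%R))) w.
Proof.
rewrite pw_word_val word_val_subst; congr word_val; apply/funext => a.
rewrite -pw_word_val pw_cat pw_zword /root_gen; congr (_ * _).
by case: eqP => // _; rewrite pw_nil.
Qed.

Lemma elim_valid i w : (forall z e, (z, e) \in elim_word i w -> valid z) ->
  zpow x i * pw hrel (word_subst Phi w) =
  pw hrel (base_word (elim_word i w)) * zpow x (i + word_wt w)%R.
Proof.
move=> V; rewrite pw_Phi pw_base_elt; apply: elim_word_eval => z e ze.
exact: elt_zpow (V z e ze).
Qed.

(** Up to conjugation by [x^i0], the image of [r] is the relator [r0]. *)
Lemma Phi_r : pw hrel (word_subst Phi r) = 1.
Proof.
have V z e : (z, e) \in elim_word i0 r -> valid z.
  rewrite -r0E => ze; have := @s_bounds z.2; rewrite /valid.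
  have z0 : z \in letters0 by apply/mapP; exists (z, e).
  by case: z ze z0 => c i ze z0 /=; case: eqP => //= Ec; apply; rewrite -Ec.
have := elim_valid V; rewrite wt_r GRing.addr0 -r0E.
rewrite (_ : pw hrel (base_word r0) = 1) => [|]; last first.
  rewrite -[RHS](pw_nil hrel) -[X in _ = pw _ X]/(base_word [::]).
  by apply: base_word_pw; rewrite pw_nil pw_rel //= fgw_id.
by rewrite mul1g -[RHS]mulg1 => /mulgI.
Qed.

Lemma Phi_pw u v : pw [set r] u = pw [set r] v ->
  pw hrel (word_subst Phi u) = pw hrel (word_subst Phi v).
Proof.
by rewrite !pw_Phi; apply: pw_lift => _ ->; rewrite -pw_Phi Phi_r.
Qed.

(** Powers of the stable letter are Britton reduced. *)
Lemma zpow_base i u : zpow x i = pw hrel (base_word u) -> i = 0%R.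
Proof.
pose bl := nseq `|i| ((i < 0)%R, [::] : word B).
have -> : zpow x i = pw hrel (block_word [::] bl).
  rewrite -pw_zword /zword /bl /block_word /=; congr pw.
  by elim: `|i|%N => //= n ->.
move=> /(britton assoc_dom_free (@shift_dom A s mu M) (@shiftK A s mu M)) bl0.
have : bl = [::].
  apply: bl0; rewrite /bl => -[p q]; move: (_ < _)%R => e.
  elim: `|i|%N => [|[|n] IH] //=.
  by rewrite inE => /predU1P[[-> ->]|]; [left | exact: IH].
by move/(congr1 size); rewrite size_nseq /=; lia.
Qed.

(** The image of [w] is [elim_word 0 w] times a power of the stable letter; if
    it is trivial, the power is trivial because it lies in the base. *)
Lemma base_elim_eq1 w :
  (forall z e, (z, e) \in elim_word 0%R w -> valid z) ->
  pw [set r] w = 1 ->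
  word_wt w = 0%R /\ pw [set r0] (elim_word 0%R w) = 1.
Proof.
move=> V w1; have := elim_valid V; rewrite mul1g GRing.add0r.
have -> : pw hrel (word_subst Phi w) = 1.
  by rewrite -(pw_nil hrel) -[[::]]/(word_subst Phi [::]); apply: Phi_pw;
    rewrite pw_nil.
move=> /esym E; have wt0 : word_wt w = 0%R.
  apply: (zpow_base (u := word_inv (elim_word 0%R w))).
  by rewrite base_word_inv pw_inv; apply/esym/mulg1_eq.
split=> //; move: E; rewrite wt0 mulg1 -(pw_nil hrel) -(pw_nil [set r0]).
exact: (base_word_inj assoc_dom_free (@shift_dom A s mu M) (@shiftK A s mu M) (v := [::])).
Qed.

(** A reduced word stays reduced under the elimination, so that freeness in the
    base implies freeness in the one-relator group. *)
Lemma step_free (D : A -> bool) (D0 : B -> bool) a0 :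
  a0 \in letters0 -> ~~ D0 a0 ->
  (forall w, word_over D w -> word_over (fun z => D0 z && valid z) (elim_word 0%R w)) ->
  free_on [set r] D.
Proof.
move=> a0r Da0 DD0 w rw Dw w1; have DV := DD0 w Dw.
have [z e ze|wt0 ew1] := base_elim_eq1 _ w1.
  by have /andP[] := allP DV _ ze.
apply: (elim_word_nil (ltn0Sn m) rw _ wt0).
apply: (free_r0 a0r _ _ ew1); first by apply: elim_word_reduced rw.
apply: sub_all DV => z /andP[Dz _] /=.
by apply: contraNneq Da0 => <-.
Qed.

(** The HNN extension is mapped to the overgroup in which [b] has a root of
    order [al], by [x |-> xi] and [(z, i) |-> xi^i z xi^-wt(z) xi^-i]. Composed
    with [Phi] this is the diagonal embedding of the one-relator group. *)
Local Notation G := (quotient_group [set r]).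
Local Notation gen := (fun a => quot_map [set r] (free_gen a)).
Local Notation xi := (adj_root (gen b) m).

Definition root_letter (a : A) : bij (G * 'I_m.+1) :=
  diag m (gen a) * zpow xi (- wt a)%R.

Definition root_base (z : B) : bij (G * 'I_m.+1) :=
  zpow xi z.2 * root_letter z.1 * zpow xi (- z.2)%R.

Definition root_hnn (o : option B) : bij (G * 'I_m.+1) :=
  if o is Some z then root_base z else xi.

Lemma root_gen_diag a : root_gen xi root_letter a = diag m (gen a).
Proof.
rewrite /root_gen /root_letter; case: eqP => [->|_]; last first.
  by rewrite -mulgA -zpowD GRing.addNr mulg1.
by rewrite mul1g /wt eqxx [zpow _ _]root_exp.
Qed.

Lemma word_val_root_hnn_base u :
  word_val root_hnn (base_word u) = word_val root_base u.
Proof. exact: word_val_map. Qed.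

Lemma word_val_root_hnn_Phi w :
  word_val root_hnn (word_subst Phi w) = diag m (pw [set r] w).
Proof.
rewrite word_val_subst pw_word_val -word_val_diag; congr word_val.
apply/funext => a; rewrite -root_gen_diag /root_gen /Phi word_val_cat.
rewrite word_val_zword; congr (_ * _); case: eqP => _; first exact: word_val_nil.
by rewrite word_val1 /letter_val /= /root_base /= mul1g mulg1.
Qed.

Lemma root_hnn_pw u v : pw hrel u = pw hrel v ->
  word_val root_hnn u = word_val root_hnn v.
Proof.
apply: pw_lift => _ [[_ -> ->]|[z Dz ->]]; rewrite word_val_fgw.
  rewrite word_val_root_hnn_base r0E.
  have := @elim_word_eval A s b al ga _ xi root_letter root_base i0 r
    (fun _ _ _ => erefl).
  rewrite wt_r GRing.addr0.
  have -> : word_val (root_gen xi root_letter) r = 1.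
    rewrite (_ : root_gen xi root_letter = fun a => diag m (gen a)).
      by rewrite word_val_diag -pw_word_val pw_rel ?diag1 //= fgw_id.
    by apply/funext => a; apply: root_gen_diag.
  by rewrite mulg1 -[X in X = _]mul1g => /mulIg.
rewrite !word_val_cat !word_val1 /letter_val /= /root_base /=.
have C k : zpow xi k * xi = xi * zpow xi k.
  by rewrite -zpowS GRing.addrC zpowD zpow1.
by rewrite zpowS C GRing.opprD zpowP !mulgA mulgV.
Qed.

Lemma word_spanMr (D : A -> bool) (h : G) : word_span D h ->
  forall g : G, word_span D (h * g) <-> word_span D g.
Proof.
move=> Dh g; split=> [Dhg|]; last exact: word_spanM.
by rewrite -(mulKg h g); apply: word_spanM => //; apply: word_spanV.
Qed.

Lemma word_span_gen (D : A -> bool) a : D a -> word_span D (gen a : G).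
Proof.
move=> Da; exists [:: (a, false)]; first by rewrite /= Da.
by rewrite pw_word_val word_val1.
Qed.

(** The subgroup is recovered from the set of its copies as the orbit of 1. *)
Lemma word_span_stable (D : A -> bool) (g : G) :
  stabilizes [set t : G * 'I_m.+1 | word_span D t.1] (diag m g) -> word_span D g.
Proof.
move=> /(_ (1, ord0)) [_ /=]; rewrite mulg1; apply; exact: word_span1.
Qed.

Lemma word_val_zpowN (K : groupType) (y : K) w :
  word_val (fun a => zpow y (- wt a)%R) w = zpow y (- word_wt w)%R.
Proof.
elim: w => [|[a e] w IH]; first by rewrite word_val_nil.
rewrite word_valE IH word_wt_cons GRing.opprD zpowD; congr (_ * _).
by rewrite /letter_val /letter_wt; case: e; rewrite //= -zpowN.
Qed.

Definition unweight (w : word A) : word (option B) :=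
  word_subst (fun a => zword None (- wt a)%R) w.

Lemma pw_unweight w : pw hrel (unweight w) = zpow x (- word_wt w)%R.
Proof.
rewrite pw_word_val word_val_subst -word_val_zpowN; congr word_val.
by apply/funext => a; rewrite -pw_word_val pw_zword.
Qed.

(** The right-hand side is a word in the letters with indices and in [x], whose
    images in the overgroup all stabilize the copies of the subgroup that omits
    [s]; conversely, the elimination of a word without [s] gives such a word.
    The factor [unweight w] cancels the power of [x]. *)
Lemma step_span_s w : word_span (predC1 s) (pw [set r] w) <->
  exists2 u, word_over (fun z => z.1 != s) u &
    pw hrel (word_subst Phi w ++ unweight w) = pw hrel (base_word u).
Proof.
split=> [[u Du wu]|[u Du E]].
  have Du0 : word_over (fun z => z.1 != s) (elim_word 0%R u).
    by apply: sub_all (elim_word_over s b al ga 0%R Du) => z /andP[].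
  exists (elim_word 0%R u) => //.
  rewrite pw_cat pw_unweight (Phi_pw wu) -[pw _ (word_subst _ _)]mul1g -(zpow0 x).
  rewrite elim_valid => [|z e ze]; last by rewrite /valid (allP Du0 _ ze).
  by rewrite GRing.add0r (word_wt_pw wt_r wu) -mulgA -zpowD GRing.subrr mulg1.
apply: word_span_stable; have := root_hnn_pw E.
rewrite word_val_cat word_val_root_hnn_Phi word_val_root_hnn_base.
rewrite /unweight word_val_subst.
rewrite (_ : (fun a => word_val root_hnn (zword None (- wt a)%R)) =
             (fun a => zpow xi (- wt a)%R)); last first.
  by apply/funext => a; rewrite word_val_zword.
rewrite word_val_zpowN zpowN => /(canRL (mulgVK _)) ->.
have sxi : stabilizes [set t | word_span (predC1 s) t.1] xi.
  apply: stabilizes_root; apply: word_spanMr; apply: word_span_gen.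
  by rewrite /= eq_sym.
apply: stabilizesM; last exact: stabilizes_zpow.
apply: stabilizes_word => z e ze; have /= zs := allP Du _ ze.
apply: stabilizesM; last exact: stabilizes_zpow.
apply: stabilizesM; first exact: stabilizes_zpow.
apply: stabilizesM; last exact: stabilizes_zpow.
by apply/stabilizes_diag/word_spanMr/word_span_gen.
Qed.

(** If [b] is the stable letter itself, a word without [b] keeps the index 0
    throughout its elimination. The set of copies considered here is not stable
    under [x], so that no power of [x] may occur. *)
Lemma step_span_b w : m = 0 -> ga = 0%R -> word_span (predC1 b) (pw [set r] w) <->
  exists2 u, word_over (fun z => (z.1 != b) && (z.2 == 0%R)) u &
    pw hrel (word_subst Phi w) = pw hrel (base_word u).
Proof.
move=> m0 ga0; split=> [[u Du wu]|[u Du E]].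
  have [D0 wt0] := elim_word_const s m.+1 0%R ga0 Du.
  have Du0 := elim_word_over s b al ga 0%R Du.
  exists (elim_word 0%R u).
    apply/allP => z zu; have /andP[_ ->] := allP Du0 _ zu.
    exact: (allP D0 _ zu).
  rewrite (Phi_pw wu) -[pw _ (word_subst _ _)]mul1g -(zpow0 x).
  rewrite elim_valid ?wt0 ?mulg1 // => z e ze.
  by rewrite /valid (eqP (allP D0 _ ze)) s_bounds ?orbT.
apply: word_span_stable; have := root_hnn_pw E.
rewrite word_val_root_hnn_Phi word_val_root_hnn_base => ->.
apply: stabilizes_word => -[a i] e ze; have /= /andP[ab /eqP ->] := allP Du _ ze.
rewrite /root_base /= mul1g mulg1 /root_letter.
rewrite (_ : wt a = 0%R); last by rewrite /wt (negbTE ab) ga0 if_same.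
by rewrite mulg1; apply/stabilizes_diag/word_spanMr/word_span_gen.
Qed.

End Step.

#[export] Instance enc_int : encoding int.
Proof.
apply: (@Encoding _ (fun i => match i with Posz n => n.*2 | Negz n => n.*2.+1 end)
                    (fun n => if odd n then Negz n./2 else Posz n./2)).
  by case=> n /=; rewrite odd_double ?doubleK //= uphalf_double.
apply: rec1_eq rec1_id _ => n.
by case: ifP => on; rewrite -[LHS]odd_double_half on.
Defined.

Lemma comp_int_succ : computable (fun i : int => (i + 1)%R).
Proof.
pose F c := if odd c == 0 :> nat then c.+2 else c - 2.
exists F.
  apply: (rec1_if rec1_odd); last exact: rec1_comp rec1_succ rec1_succ.
  exact: rec1_comp2 rec2_sub rec1_id (rec1_const 2).
case=> [n|[|n]] //.
  rewrite (_ : (Posz n + 1)%R = Posz n.+1); last by lia.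
  by rewrite /F /= odd_double.
rewrite (_ : (Negz n.+1 + 1)%R = Negz n); last by lia.
by rewrite /F /= odd_double /=; lia.
Qed.

Lemma comp_word_subst (A B : Type) (eA : encoding A) (eB : encoding B)
    X (eX : encoding X) (f : A -> word B) (w : X -> word A) :
  computable f -> computable w -> computable (fun t => word_subst f (w t)).
Proof.
move=> cf cw; apply/comp_flatten/(comp_map
  (g := fun _ x => if x.2 then word_inv (f x.1) else f x.1)) => //.
have c1 : computable (fun p : X * (A * bool) => f p.2.1).
  exact: comp_comp cf (comp_fst (comp_snd comp_id)).
apply: comp_if => //; first exact: comp_snd (comp_snd comp_id).
apply: comp_rev; apply: (comp_map
  (g := fun _ (x : B * bool) => (x.1, ~~ x.2))) => //.
by apply: comp_pair; [exact: comp_fst (comp_snd comp_id)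
                     |exact: comp_negb (comp_snd (comp_snd comp_id))].
Qed.

(** * The inductive step *)

(** It suffices to omit one letter of the relator: the subgroups that omit more
    letters are generated by parts of a basis, and [enum_not_span_sub] applies
    to them. *)
Definition magnus (A : eqType) (eA : encoding A) (r : free_group A) : Prop :=
  forall a, a \in unzip1 (r : word A) ->
    free_on [set r] (predC1 a) /\
    enumerable (fun w => ~ word_span (predC1 a) (pw [set r] w)).

Lemma comp_predC1 (A : eqType) (eA : encoding A) (a : A) : computable (predC1 a).
Proof. by apply/comp_negb/comp_eq; [exact: comp_id | exact: comp_const]. Qed.

Section StepEnum.
Variables (A : eqType) (eA : encoding A).
Variables (r : free_group A) (s b : A) (m : nat) (ga : int).
Hypothesis sNb : s != b.
Hypothesis wt_r : word_wt s b m.+1 ga r = 0%R.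
Variables (i0 mu M : int) (r0 : free_group (A * int)).
Local Notation letters0 := (unzip1 (r0 : word (A * int))).
Hypothesis r0E : r0 = elim_word s b m.+1 ga i0 r :> word _.
Hypothesis s_bounds : forall i, (s, i) \in letters0 -> (mu <= i <= M)%R.
Hypotheses (s_0 : (s, 0%R : int) \in letters0) (s_mu : (s, mu) \in letters0)
           (s_M : (s, M) \in letters0).
Hypothesis IH : magnus _ r0.

Let free_r0 a (ar : a \in letters0) : free_on [set r0] (predC1 a) := (IH ar).1.

Lemma comp_shift : computable (@shift A false).
Proof.
apply: comp_pair; first exact: comp_fst comp_id.
exact: comp_comp comp_int_succ (comp_snd comp_id).
Qed.

Lemma comp_neq_const (z : A * int) : computable (fun y => y != z).
Proof. exact: comp_predC1. Qed.

Lemma comp_assoc_dom e : computable (assoc_dom s mu M e).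
Proof. by case: e; apply: comp_andb; apply: comp_neq_const. Qed.

Lemma enum_assoc_dom e :
  enumerable (fun w => ~ word_span (assoc_dom s mu M e) (pw [set r0] w)).
Proof.
have [z zr zD] : exists2 z, z \in letters0 & forall y, assoc_dom s mu M e y -> y != z.
  by case: e; [exists (s, mu) | exists (s, M)] => // y /andP[].
have [fz ez] := IH zr.
exact: (enum_not_span_sub (comp_predC1 _ z) (comp_assoc_dom e) zD fz ez).
Qed.

Lemma enum_hnn_not_base (D : A * int -> bool) z : computable D ->
  z \in letters0 -> ~~ D z ->
  enumerable (fun v => ~ exists2 u, word_over D u &
    pw (hnn_rel [set r0] (assoc_dom s mu M) (@shift A)) v =
    pw (hnn_rel [set r0] (assoc_dom s mu M) (@shift A)) (base_word u)).
Proof.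
move=> cD zr Dz; have [fz ez] := IH zr.
apply: enum_not_base.
- exact: (assoc_dom_free s_mu s_M free_r0).
- exact: shift_dom.
- exact: shiftK.
- exact: comp_assoc_dom.
- exact: comp_shift.
- exact: enum_assoc_dom.
apply: (enum_not_span_sub (comp_predC1 _ z) cD _ fz ez) => y Dy.
by apply: contraNneq Dz => <-.
Qed.

Lemma comp_zword_wt (f : int -> int) :
  computable (fun a => zword (None : option (A * int)) (f (wt s b m.+1 ga a))).
Proof.
apply: (@computable_eq _ _ _ _ (fun a => if a == b then zword None (f m.+1)
  else if a == s then zword None (f ga) else zword None (f 0%R))); last first.
  by move=> a; rewrite /wt; case: ifP => // _; case: ifP.
have c1 c : computable (fun a : A => a == c).
  by apply: comp_eq; [exact: comp_id | exact: comp_const].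
by apply: comp_if => //; [exact: comp_const | apply: comp_if => //; exact: comp_const].
Qed.

Lemma comp_Phi X (eX : encoding X) (w : X -> word A) :
  computable w -> computable (fun t => word_subst (Phi s b m ga) (w t)).
Proof.
move=> cw; apply: comp_word_subst => //; apply: comp_cat.
  apply: comp_if; [|exact: comp_const|].
    by apply: comp_eq; [exact: comp_id | exact: comp_const].
  apply: comp_cons; last exact: comp_const.
  apply: comp_pair; last exact: comp_const.
  by apply/comp_Some/comp_pair; [exact: comp_id | exact: comp_const].
exact: (comp_zword_wt id).
Qed.

Lemma magnus_s : free_on [set r] (predC1 s) /\
  enumerable (fun w => ~ word_span (predC1 s) (pw [set r] w)).
Proof.
have cD : computable (fun z : A * int => z.1 != s).
  by apply/comp_negb/comp_eq; [exact: comp_fst comp_id | exact: comp_const].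
split.
  apply: (step_free sNb wt_r r0E s_bounds s_0 s_mu s_M free_r0
    (D0 := fun z => z.1 != s) s_0); first by rewrite /= eqxx.
  move=> w Dw; apply: sub_all (elim_word_over s b m.+1 ga 0%R Dw) => z.
  by rewrite /valid => /andP[/= ->].
have Ds : ~~ ((s, 0%R : int).1 != s) by rewrite eqxx.
have e0 := enum_hnn_not_base cD s_0 Ds.
apply: enum_iff (enum_comp (f := fun w =>
  word_subst (Phi s b m ga) w ++ unweight s b m ga w) e0 _).
  by move=> w; rewrite (step_span_s sNb wt_r r0E s_bounds s_0 s_mu s_M).
apply: comp_cat; first exact: comp_Phi comp_id.
exact: comp_word_subst (comp_zword_wt (@GRing.opp int)) comp_id.
Qed.

Lemma magnus_b z : m = 0 -> ga = 0%R -> z \in letters0 -> z.2 != 0%R ->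
  free_on [set r] (predC1 b) /\
  enumerable (fun w => ~ word_span (predC1 b) (pw [set r] w)).
Proof.
move=> m0 ga0 zr z0.
pose D0 (y : A * int) := (y.1 != b) && (y.2 == 0%R).
have cD : computable D0.
  apply: comp_andb.
    by apply/comp_negb/comp_eq; [exact: comp_fst comp_id | exact: comp_const].
  by apply/comp_eq; [exact: comp_snd comp_id | exact: comp_const].
have Dz : ~~ D0 z by rewrite /D0 (negbTE z0) andbF.
split.
  apply: (step_free sNb wt_r r0E s_bounds s_0 s_mu s_M free_r0 zr Dz) => w Dw.
  have [/allP D1 _] := elim_word_const s m.+1 0%R ga0 Dw.
  apply/allP => y yw; have /andP[_ yb] := allP (elim_word_over s b m.+1 ga 0%R Dw) _ yw.
  have /eqP y0 := D1 _ yw; rewrite /D0 yb y0 eqxx /valid y0.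
  by rewrite s_bounds ?orbT.
have e0 := enum_hnn_not_base cD zr Dz.
apply: enum_iff (enum_comp (f := word_subst (Phi s b m ga)) e0 _).
  by move=> w; rewrite (step_span_b sNb wt_r r0E s_bounds s_0 s_mu s_M w m0 ga0).
exact: comp_Phi comp_id.
Qed.

End StepEnum.

Lemma seq_int_bounds (l : seq int) x : x \in l ->
  exists2 i, i \in l & forall y, y \in l -> (i <= y)%R.
Proof.
elim: l x => // y l IH x _; case: l IH => [|z l] IH.
  by exists y; rewrite ?mem_head // => z; rewrite inE => /eqP->.
have [i il imin] := IH z (mem_head _ _).
have [yi|iy] := boolP (y <= i)%R.
  exists y; first exact: mem_head.
  by move=> t; rewrite inE => /predU1P[->|/imin]; lia.
exists i; first by rewrite inE il orbT.
by move=> t; rewrite inE => /predU1P[->|/imin]; lia.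
Qed.

Lemma seq_int_upper_bound (l : seq int) x : x \in l ->
  exists2 i, i \in l & forall y, y \in l -> (y <= i)%R.
Proof.
move=> xl; have xl' : (- x)%R \in map -%R%R l by apply: map_f.
have [_ /mapP[i il ->] imax] := seq_int_bounds xl'.
by exists i => // y yl; have := imax _ (map_f -%R%R yl); lia.
Qed.

(** Cyclic reducedness expressed through a reduced word, which makes it stable
    under the elimination. *)
Definition square_reduced (A : Type) (w : word A) : bool := reduced (w ++ w).

Section StepData.
Variables (A : eqType) (s b : A) (al : nat) (ga : int).
Hypotheses (sNb : s != b) (al_gt0 : 0 < al).
Local Notation elim_word := (elim_word s b al ga).
Local Notation word_wt := (word_wt s b al ga).
Local Notation letters w := (unzip1 (w : word _)).

Lemma mem_elim_word i (w : word A) :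
  s \in letters w -> exists j, (s, j) \in letters (elim_word i w).
Proof.
elim: w i => //= x w IH i; rewrite inE => /predU1P[<-|sw].
  rewrite (negbTE sNb); eexists; exact: mem_head.
have [j jw] := IH (i + letter_wt s b al ga x)%R sw; exists j.
by case: ifP => //= _; rewrite inE jw orbT.
Qed.

(** The starting index [i0] is chosen for [s] to occur with the index 0, at
    which [Phi] places it. *)
Lemma elim_word_data (r : word A) : square_reduced r -> word_wt r = 0%R ->
  s \in letters r -> exists i0 mu M (r0 : free_group (A * int)),
  [/\ r0 = elim_word i0 r :> word _, square_reduced r0,
      (s, 0%R : int) \in letters r0 &
      [/\ (s, mu) \in letters r0, (s, M) \in letters r0 &
        forall i, (s, i) \in letters r0 -> (mu <= i <= M)%R]].
Proof.
move=> rr wtr /(mem_elim_word 0%R) [j jr].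
pose i0 := (- j)%R; have rr0 : reduced (elim_word i0 (r ++ r)) by apply: elim_word_reduced.
rewrite elim_word_cat wtr GRing.addr0 in rr0.
pose r0 := FreeGroup (reduced_catl rr0).
have s0 : (s, 0%R : int) \in letters r0.
  rewrite /= /i0 -[(- j)%R]GRing.add0r elim_word_shift /unzip1 -map_comp.
  have /mapP[[z e] ze /= zE] := jr; apply/mapP; exists (z, e) => //=.
  by rewrite -zE /=; congr pair; lia.
pose l := [seq z.2 | z <- letters r0 & z.1 == s].
have lP i : (s, i) \in letters r0 <-> i \in l.
  split=> [ir|/mapP[[c k]]]; first by apply/mapP; exists (s, i); rewrite // mem_filter eqxx.
  by rewrite mem_filter /= => /andP[/eqP -> kr] ->.
have [mu mul mumin] := seq_int_bounds ((lP _).1 s0).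
have [M Ml Mmax] := seq_int_upper_bound ((lP _).1 s0).
exists i0, mu, M, r0; split=> //; split; [exact/lP|exact/lP|].
by move=> i /lP il; rewrite mumin ?Mmax.
Qed.

(** If the letter [b] has been eliminated as a stable letter, the indices are
    not all zero: between two occurrences of other letters of a cyclically
    reduced word, the powers of [b] are not trivial. *)
Lemma elim_word_index_neq0 i0 (r : word A) : ga = 0%R ->
  square_reduced r -> word_wt r = 0%R -> s \in letters r -> b \in letters r ->
  (s, 0%R : int) \in letters (elim_word i0 r) ->
  exists2 z, z \in letters (elim_word i0 r) & z.2 != 0%R.
Proof.
move=> ga0 rr wtr sr br s0.
have [/hasP[z zr z0]|/hasPn r0] := boolP (has (fun z => z.2 != 0%R) (letters (elim_word i0 r))).
  by exists z.
have {}r0 : all (fun x => x.1.2 == 0%R) (elim_word i0 r).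
  by apply/allP => x xr; have := r0 _ (map_f fst xr); rewrite negbK.
have /mapP[[c e] ce /= sc] := sr; rewrite -{c}sc in ce.
move: br; case/splitPr: ce rr wtr r0 {sr s0} => u v rr wtr r0.
have ls : letter_wt s b al ga (s, e) = 0%R by apply: letter_wt0.
move: r0; rewrite elim_word_cat all_cat elim_word_cons //= ls GRing.addr0 if_same.
case/andP=> u0 /andP[/eqP j0]; rewrite j0 => v0.
move: wtr; rewrite word_wt_cat word_wt_cons ls GRing.add0r => wtr.
have vu : reduced (v ++ u).
  have : reduced ((u ++ [:: (s, e)]) ++ ((v ++ u) ++ (s, e) :: v)).
    by move: rr; rewrite /square_reduced -!catA.
  by move/reduced_catr/reduced_catl.
have bvu : all (fun x => x.1 != b) (v ++ u).
  apply: (@elim_word_index0 A s b al ga al_gt0 _ ga0 vu).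
    by rewrite word_wt_cat; move: wtr; lia.
  rewrite elim_word_cat all_cat v0 (_ : (0 + word_wt v)%R = i0) //.
  by move: j0 wtr; lia.
rewrite /unzip1 map_cat mem_cat /= inE eq_sym (negbTE sNb) /=.
move: bvu; rewrite all_cat => /andP[bv bu].
by case/orP=> /mapP[x xw bx]; [have := allP bu _ xw | have := allP bv _ xw];
  rewrite -bx eqxx.
Qed.

End StepData.

Definition exp_sum (A : eqType) (a : A) (w : word A) : int :=
  foldr (fun x i => ((if x.1 == a then if x.2 then -1 else 1 else 0) + i)%R) 0%R w.

Lemma word_wt_exp_sum (A : eqType) (s b : A) al ga (w : word A) : s != b ->
  word_wt s b al ga w = (Posz al * exp_sum b w + ga * exp_sum s w)%R.
Proof.
move=> sb; elim: w => [|[z e] w IH] /=; first by rewrite !GRing.mulr0.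
rewrite IH /letter_wt /wt /=.
have [->|zb] := eqVneq z b; first by rewrite eq_sym (negbTE sb); case: e; lia.
by case: eqP; case: e; lia.
Qed.

(** * Relators with a single letter *)

Section PowerRelator.
Variables (A : eqType) (eA : encoding A) (r : free_group A) (a : A) (e : bool).
Variable n : nat.
Hypothesis rE : r = nseq n.+1 (a, e) :> word A.

(** The normal form [(k0, [:: (x1, k1); ...])] stands for
    [y^k0 x1 y^k1 ...] with [y = (a, e)], exponents [ki <= n] and letters [xi]
    other than [a], without cancellation [x y^0 x^-1]. *)
Definition pform : Type := (nat * seq ((A * bool) * nat))%type.

Fixpoint is_pnf (l : seq ((A * bool) * nat)) : bool :=
  if l is p :: s then
    [&& p.1.1 != a, p.2 <= n,
      (if s is q :: _ then (p.2 == 0) ==> (q.1 != letter_inv p.1) else true)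
      & is_pnf s]
  else true.

Definition pact (x : A * bool) (t : pform) : pform :=
  if x.1 == a then
    (if x.2 == e then if t.1 == n then 0 else t.1.+1
     else if t.1 == 0 then n else t.1.-1, t.2)
  else if t.2 is q :: s then
    if (t.1 == 0) && (q.1 == letter_inv x) then (q.2, s) else (0, (x, t.1) :: t.2)
  else (0, [:: (x, t.1)]).

Definition pinv (t : pform) : Prop := (t.1 <= n) && is_pnf t.2.

Lemma pact_inv x t : pinv t -> pinv (pact x t).
Proof.
case: t => k l; rewrite /pinv /pact /=; case: eqP => xa /= /andP[kn nl].
  by rewrite nl andbT; case: ifP => _; case: ifP => /eqP; lia.
case: l nl => [_|[y k'] s nl] /=; first by rewrite kn !andbT; apply/eqP.
case: ifP => [_|E]; first by case/and4P: nl => _ k'n _ ns; apply/andP.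
rewrite -[is_pnf _]/[&& x.1 != a, k <= n, (k == 0) ==> (y != letter_inv x)
  & is_pnf ((y, k') :: s)] nl kn andbT /=; apply/andP; split; first by apply/eqP.
by apply/implyP => /eqP k0; rewrite k0 eqxx /= in E; rewrite E.
Qed.

Lemma pactK x t : pinv t -> pact (letter_inv x) (pact x t) = t.
Proof.
case: t => k l; rewrite /pinv /pact /=; case: eqP => xa /= /andP[kn nl].
  congr pair; case: (x.2) (e) => [] [] /=;
    by case: (k =P n) => /= ?; case: (k =P 0) => /= ?; rewrite ?eqxx;
      try case: eqP; lia.
case: l nl => [_|[y k'] s /and4P[/= ya k'n ys ns]] /=.
  by rewrite letter_invK eqxx.
case: ifP => [/andP[/eqP -> /eqP yx]|E] /=; last by rewrite letter_invK eqxx.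
case: s ys ns => [|q s] ys ns; rewrite -yx //.
by case: eqP ys => //= _ /negbTE ->.
Qed.

Lemma pact_run (i : nat) (k : nat) l : k + i <= n ->
  act_word pact (nseq i (a, e)) (k, l) = (k + i, l).
Proof.
elim: i => [|i IH] H; first by rewrite addn0.
rewrite /= -/(act_word pact _ _) IH; last by lia.
by rewrite /pact /= !eqxx ifF; [rewrite addnS | lia].
Qed.

(** The exponent in front runs once through its cycle of [n + 1] values. *)
Lemma pact_rel t : pinv t -> act_word pact r t = t.
Proof.
case: t => k l /andP[/= kn _]; rewrite rE.
have -> : n.+1 = k + (n - k).+1 by lia.
rewrite nseqD act_word_cat /= -/(act_word pact _ _) pact_run; last by lia.
rewrite [pact (a, e) _]/pact /= !eqxx ifT; last by lia.
by rewrite pact_run.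
Qed.

Definition pval (t : pform) : word A :=
  nseq t.1 (a, e) ++ flatten [seq p.1 :: nseq p.2 (a, e) | p <- t.2].

Definition pnf (w : word A) : pform := act_word pact w (0, [::]).

Lemma pnf_inv w : pinv (pnf w).
Proof. by apply: act_word_inv; [exact: pact_inv | by []]. Qed.

Lemma pw_letterK x w : pw [set r] (letter_inv x :: x :: w) = pw [set r] w.
Proof.
rewrite -[_ :: _]/([:: letter_inv x; x] ++ w) pw_cat.
rewrite (_ : pw _ [:: _; _] = 1) ?mul1g // -(pw_nil [set r]); apply: pw_eq.
by rewrite fgw_nil -(fgw_letterV (letter_inv x)) letter_invK.
Qed.

Lemma pw_pact x t : pinv t -> pw [set r] (x :: pval t) = pw [set r] (pval (pact x t)).
Proof.
have y0 : pw [set r] (nseq n.+1 (a, e)) = 1 by rewrite -rE; apply: pw_rel; rewrite fgw_id.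
case: t => k l /andP[/= kn _]; rewrite /pact; case: eqP => xa /=; last first.
  case: l => [|[y k'] s] //=; case: ifP => [/andP[/eqP-> /eqP /= ->]|_] //.
  by rewrite /pval /= -{1}[x]letter_invK pw_letterK.
rewrite /pval [x]surjective_pairing xa /=; set u := flatten _.
case: eqP => [-> | ne] /=.
  case: eqP => [->|_] //.
  by rewrite -[_ :: _]/(nseq n.+1 (a, e) ++ u) pw_cat y0 mul1g.
have -> : x.2 = ~~ e by case: (x.2) (e) ne => [] [].
case: eqP => [->|k0] /=; last first.
  by case: k k0 {kn} => // k _; rewrite /= -[(a, ~~ e)]/(letter_inv (a, e)) pw_letterK.
rewrite -[_ :: u]cat1s !pw_cat; congr (_ * _).
rewrite -[LHS]mulg1 -y0 -pw_cat -[nseq n.+1 _]/((a, e) :: nseq n (a, e)).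
exact: (pw_letterK (a, e)).
Qed.

Lemma pw_pnf w : pw [set r] w = pw [set r] (pval (pnf w)).
Proof.
elim: w => // x w IH; rewrite pw_cons IH -pw_cat.
exact: pw_pact (pnf_inv w).
Qed.

Lemma pnf_pw u v : pw [set r] u = pw [set r] v -> pnf u = pnf v.
Proof.
move=> uv; apply: (act_pw (I := pinv)) uv _ _ => //.
- exact: pact_inv.
- exact: pactK.
by move=> _ ->; apply: pact_rel.
Qed.

Definition pzero (t : pform) : bool := (t.1 == 0) && all (fun p => p.2 == 0) t.2.

Lemma pnf_over u : word_over (predC1 a) u -> pzero (pnf u).
Proof.
elim: u => // x u IH /andP[/= xa /IH].
rewrite /pnf /= -/(act_word pact u _) -/(pnf u) /pact (negbTE xa).
case: (pnf u) => k l /andP[/= /eqP -> l0].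
case: l l0 => //= q s /andP[q0 s0].
by case: ifP => _; rewrite /pzero /= ?q0 ?s0.
Qed.

Lemma pnf_reduced w : reduced w -> word_over (predC1 a) w ->
  pnf w = (0, [seq (x, 0) | x <- w]).
Proof.
elim: w => // x w IH rw /andP[/= xa wa].
rewrite /pnf /= -/(act_word pact w _) -/(pnf w) IH //; last exact: reduced_behead rw.
rewrite /pact (negbTE xa); case: w rw {IH wa} => //= y w rw.
by move: rw => /andP[]; rewrite asbool_neg asbool_eqE => /negbTE ->.
Qed.

Lemma span_pnf w : word_span (predC1 a) (pw [set r] w) <-> pzero (pnf w).
Proof.
split=> [[u Du /pnf_pw ->]|]; first exact: pnf_over.
rewrite pw_pnf; have := pnf_inv w; case: (pnf w) => k l /andP[_ /= nl].
rewrite /pzero /pval /= => /andP[/eqP -> l0] /=.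
eexists; last by [].
elim: l nl l0 => //= p l IH /and4P[pa _ _ nl] /andP[/eqP -> l0] /=.
by rewrite pa; apply: IH.
Qed.

(** An element lies in the subgroup of the other letters if and only if all
    exponents of its normal form vanish, which can be computed. *)
Lemma magnus_power :
  free_on [set r] (predC1 a) /\
  enumerable (fun w => ~ word_span (predC1 a) (pw [set r] w)).
Proof.
split=> [w rw wa w1|].
  have := pnf_pw (etrans w1 (esym (pw_nil _))).
  by rewrite pnf_reduced //; case: w {rw wa w1}.
apply: (@enum_iff _ _ (fun w => ~~ pzero (pnf w))).
  by move=> w; rewrite span_pnf; split=> [/negP|/negP].
have cnf : computable pnf.
  apply: (comp_foldr (g := fun _ => pact) (i := fun=> (0, [::]))); last exact: comp_id.
    pose Z := (word A * ((A * bool) * pform))%type.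
    have cx : computable (fun z : Z => z.2.1) by exact: comp_fst (comp_snd comp_id).
    have ct1 : computable (fun z : Z => z.2.2.1).
      exact: comp_fst (comp_snd (comp_snd comp_id)).
    have ct2 : computable (fun z : Z => z.2.2.2).
      exact: comp_snd (comp_snd (comp_snd comp_id)).
    have cn : computable (fun _ : Z => n) by exact: comp_const.
    have c0 : computable (fun _ : Z => 0) by exact: comp_const.
    have cS : computable succn by exists succn => //; apply: rec1_succ.
    have cP : computable predn by exists predn => //; apply: rec1_pred.
    apply: comp_if; first by apply: comp_eq; [exact: comp_fst | exact: comp_const].
      apply: comp_pair => //; apply: comp_if.
      - by apply: comp_eq; [exact: comp_snd | exact: comp_const].
      - apply: comp_if => //; first exact: comp_eq.
        exact: comp_comp cS ct1.
      - apply: comp_if => //; first exact: comp_eq.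
        exact: comp_comp cP ct1.
    apply: (comp_case (h := fun (z : Z) q s =>
      if (z.2.2.1 == 0) && (q.1 == letter_inv z.2.1) then (q.2, s)
      else (0, (z.2.1, z.2.2.1) :: z.2.2.2))
      (d := fun z : Z => (0, [:: (z.2.1, z.2.2.1)]))) => //; last first.
      apply: comp_pair => //; apply: comp_cons; first exact: comp_pair.
      exact: comp_const.
    pose Z' := (Z * (((A * bool) * nat) * seq ((A * bool) * nat)))%type.
    have lift (Y : Type) (eY : encoding Y) (f : Z -> Y) :
        computable f -> computable (fun z : Z' => f z.1).
      by move=> cf; apply: comp_comp cf (comp_fst comp_id).
    have cq : computable (fun z : Z' => z.2.1) by exact: comp_fst (comp_snd comp_id).
    have cs : computable (fun z : Z' => z.2.2) by exact: comp_snd (comp_snd comp_id).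
    apply: comp_if.
    - apply: comp_andb; first exact: (lift _ _ _ (comp_eq ct1 c0)).
      apply: comp_eq; first exact: comp_fst cq.
      apply: (lift _ _ (fun z : Z => letter_inv z.2.1)).
      exact: comp_letter_inv cx.
    - exact: comp_pair (comp_snd cq) cs.
    apply: (lift _ _ (fun z : Z => (0, (z.2.1, z.2.2.1) :: z.2.2.2))).
    by apply: comp_pair => //; apply: comp_cons => //; exact: comp_pair.
  exact: comp_const.
apply/enum_dec/comp_negb/comp_andb.
  by apply: comp_eq; [exact: comp_fst cnf | exact: comp_const].
apply: (comp_all (p := fun _ (p : (A * bool) * nat) => p.2 == 0)).
  by apply: comp_eq; [exact: comp_snd (comp_snd comp_id) | exact: comp_const].
exact: comp_snd cnf.
Qed.

End PowerRelator.

(** * The induction *)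

Lemma reduced_single_letter (A : eqType) (a : A) (w : word A) :
  reduced w -> all (fun x => x.1 == a) w -> exists n e, w = nseq n (a, e).
Proof.
move=> rw aw; have [n [e [u [E hu]]]] := run_split a rw.
exists n, e; case: u E hu => [|x u] E; first by rewrite E cats0.
by move: aw; rewrite E all_cat /= => /and3P[_ -> _].
Qed.

(** The relator of the base has lost the letters [b], whence the induction on
    the length. *)
Lemma magnus_all (A : eqType) (eA : encoding A) (r : free_group A) :
  square_reduced r -> magnus eA r.
Proof.
have [n] := ubnP (size (r : word A)).
elim: n => // n IH in A eA r * => sr rr a ar.
have rE : reduced r by exact: fg_reduced.
have [allr|/allPn[[c e] /= cr ca]] := boolP (all (fun x => x.1 == a) (r : word A)).
  have [k [e kE]] := reduced_single_letter rE allr.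
  case: k kE => [|k] kE; first by rewrite kE in ar.
  exact: magnus_power kE.
have {e}cr : c \in unzip1 (r : word A) by apply/mapP; exists (c, e).
have size_elim s b al ga i : b \in unzip1 (r : word A) ->
    size (elim_word s b al ga i r) < n.
  move=> /mapP[x xr bx]; rewrite size_elim_word.
  have : has (fun x => x.1 == b) (r : word A) by apply/hasP; exists x; rewrite ?bx.
  rewrite has_count; have := count_predC (fun x => x.1 == b) (r : word A).
  rewrite -[count (predC _) _]/(count (fun x => x.1 != b) (r : word A)).
  by move: sr; rewrite ltnS; lia.
have [a0|a0] := eqVneq (exp_sum a r) 0%R.
  have wtr : word_wt c a 1%N 0%R r = 0%R.
    by rewrite word_wt_exp_sum // a0 GRing.mulr0 GRing.mul0r.
  have [i0 [mu [M [r0 [r0E rr0 s0 [smu sM sb]]]]]] :=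
    elim_word_data ca (isT : 0 < 1)%N rr wtr cr.
  have s0' := s0; rewrite r0E in s0'.
  have [z zr z0] := elim_word_index_neq0 ca (isT : 0 < 1)%N erefl rr wtr cr ar s0'.
  apply: (magnus_b ca wtr r0E sb s0 smu sM _ erefl erefl (z := z)) => //.
    by apply: IH => //; rewrite r0E size_elim.
  by rewrite r0E.
have ac : a != c by rewrite eq_sym.
pose al := `|exp_sum a r|%N.
have al_gt0 : 0 < al by rewrite /al; lia.
pose ga : int := if (exp_sum a r < 0)%R then exp_sum c r else (- exp_sum c r)%R.
have wtr : word_wt a c al.-1.+1 ga r = 0%R.
  rewrite word_wt_exp_sum // prednK // /al /ga.
  by case: ifP => ?; nia.
have [i0 [mu [M [r0 [r0E rr0 s0 [smu sM sb]]]]]] :=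
  elim_word_data ac (isT : 0 < al.-1.+1)%N rr wtr ar.
apply: (magnus_s ac wtr r0E sb s0 smu sM).
by apply: IH => //; rewrite r0E size_elim.
Qed.

Section Consequences.
Variables (A : eqType) (eA : encoding A) (r : free_group A).
Hypotheses (rr : square_reduced r).

Lemma freiheitssatz (D : A -> bool) a : a \in unzip1 (r : word A) -> ~~ D a ->
  free_on [set r] D.
Proof.
move=> ar Da; apply: free_on_sub (magnus_all eA rr ar).1 => c Dc /=.
by apply: contraNneq Da => <-.
Qed.

(** The trivial subgroup is generated by the empty part of a basis. *)
Lemma word_problem_computable : r <> 1 ->
  exists2 d : word A -> bool, computable d & forall w, d w <-> pw [set r] w = 1.
Proof.
move=> rN1; have [a ar] : exists a, a \in unzip1 (r : word A).
  case: r rN1 => -[|x w] rw rN1; last by exists x.1; rewrite /= mem_head.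
  by case: rN1; apply: val_inj.
have [fa ea] := magnus_all eA rr ar.
have e1 : enumerable (fun w : word A => pw [set r] w = 1).
  apply: (@enum_iff _ _ (fun w => pw [set r] w = pw [set r] [::])).
    by move=> w; rewrite pw_nil.
  apply: (enum_comp (enum_one_relator eA r) (f := fun w => (w, [::]))).
  by apply: comp_pair; [exact: comp_id | exact: comp_const].
apply: enum_decidable => //.
have e0 := enum_not_span_sub (D' := fun=> false) (comp_predC1 eA a)
  (comp_const _) (fun _ => ltac:(done)) fa ea.
apply: enum_iff e0 => w; split=> nw w1; apply: nw.
  by exists [::]; rewrite ?w1 ?pw_nil.
by case: w1 => -[|x u] //= _ ->; rewrite pw_nil.
Qed.

End Consequences.

(** * Renaming of the letters *)

Lemma cyclically_reduced_square (A : Type) (w : word A) :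
  cyclically_reduced w -> square_reduced w.
Proof.
case=> rw; case: w rw => // x s rw /(_ x s erefl) xs.
rewrite /square_reduced /reduced cat_cons /= cat_path /=.
by move: rw; rewrite /reduced /= => ->; rewrite asboolT.
Qed.

Lemma reduced_map (A B : eqType) (f : A -> B) (w : word A) :
  {in unzip1 w &, injective f} -> reduced w -> reduced (word_map f w).
Proof.
elim: w => // x [|y w] IH inj //; rewrite reduced2 => /andP[xy rw].
rewrite -[word_map f _]/[:: (f x.1, x.2), (f y.1, y.2) & word_map f w].
rewrite reduced2; apply/andP; split; last first.
  by apply: IH rw => a c aw cw; apply: inj; rewrite inE ?aw ?cw orbT.
apply: contraNneq xy => -[fxy exy]; rewrite [y]surjective_pairing exy.
by rewrite (inj _ _ _ _ fxy) ?eqxx // !inE eqxx ?orbT.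
Qed.

Lemma square_reduced_map (A B : eqType) (f : A -> B) (w : word A) :
  {in unzip1 w &, injective f} -> square_reduced w ->
  square_reduced (word_map f w).
Proof.
move=> inj rw; rewrite /square_reduced -word_map_cat; apply: reduced_map => //.
by move=> a c; rewrite /unzip1 map_cat !mem_cat !orbb; apply: inj.
Qed.

Lemma one_relator_val (A : Type) (r : free_group A) (w : word A) :
  word_val (one_relator_gen r) w = pw [set r] w.
Proof. by rewrite pw_word_val. Qed.

Lemma pw_map_eq1 (A B : Type) (f : A -> B) (r : free_group A) (r' : free_group B)
    (w : word A) : r' = word_map f r :> word B ->
  pw [set r] w = 1 -> pw [set r'] (word_map f w) = 1.
Proof.
move=> r'E; rewrite -(pw_nil [set r]) => w1.
rewrite pw_word_val word_val_map -[RHS](word_val_nil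
  ((fun b => quot_map [set r'] (free_gen b)) \o f)).
apply: pw_lift w1 => _ ->.
by rewrite -(word_val_map _ f) -r'E -pw_word_val pw_rel //= fgw_id.
Qed.

Section GeneralAlphabet.
Variables (A : Type) (r : free_group A).
Hypotheses (r_neq1 : r <> 1) (r_cyc : cyclically_reduced r).

(** The finitely many letters of the relator and of a word are numbered by their
    positions in a list, which gives a word in the natural numbers. *)
Lemma freiheitssatz_set (A0 : set A) : ~ (letters r `<=` A0) ->
  injective (free_lift (fun a : set_type A0 => one_relator_gen r (sval a))).
Proof.
move=> rA0; apply: gmulf_inj => u u1.
have [a ar aA0] : exists2 a, letters r a & ~ A0 a.
  by apply: contrapT => nex; apply: rA0 => a ar; apply: contrapT => aA0;
    apply: nex; exists a.
pose w : word A := word_map sval u.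
have w1 : pw [set r] w = 1.
  by rewrite -one_relator_val /w word_val_map.
pose C : eqType := {classic A}.
pose rC : word C := r; pose wC : word C := w.
pose idx (c : C) : nat := index c (unzip1 rC ++ unzip1 wC).
have idx_inj : {in unzip1 rC ++ unzip1 wC &, injective idx}.
  by move=> c d cl dl /(congr1 (nth c (unzip1 rC ++ unzip1 wC))); rewrite !nth_index.
have rr' : square_reduced (word_map idx rC).
  apply: square_reduced_map; last exact: cyclically_reduced_square.
  by move=> c d cr dr; apply: idx_inj; rewrite mem_cat ?cr ?dr.
pose r' := FreeGroup (reduced_catl rr').
have w'1 := @pw_map_eq1 C nat idx r r' wC erefl w1.
have ar' : (a : C) \in unzip1 rC.
  by case: ar => u1' [b [v E]]; rewrite /rC E /unzip1 map_cat mem_cat /= mem_head orbT.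
have w'0 : word_map idx wC = [::].
  apply: (@freiheitssatz _ _ r' rr' (predC1 (idx a)) (idx a)) => //.
  - by rewrite /= /unzip1 -map_comp; apply/mapP; have /mapP[x xr ->] := ar'; exists x.
  - by rewrite /= eqxx.
  - apply: reduced_map.
      by move=> c d cr dr; apply: idx_inj; rewrite mem_cat ?cr ?dr orbT.
    rewrite /reduced /wC /w /word_map sorted_map.
    apply: sub_sorted (fg_reduced u) => x y /asboolP nxy; apply/asboolP => -[E1 E2].
    apply: nxy; case: x y E1 E2 => [x b] [y c] /= E1 ->; congr pair.
    exact: val_inj.
  rewrite /word_over all_map; apply/allP => x xw /=.
  apply/eqP => E; apply: aA0.
  have xC : x.1 \in unzip1 wC by apply: map_f.
  have <- : x.1 = a by apply: idx_inj E; rewrite mem_cat ?xC ?ar' ?orbT.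
  have wA0 : all (fun y : C * bool => `[< A0 y.1 >]) wC.
    rewrite /wC /w /word_map all_map.
    by apply: sub_all (all_predT _) => y _; apply/asboolP/set_mem/(valP y.1).
  by have /asboolP := allP wA0 x xw.
by apply: val_inj; apply: size0nil; have := congr1 size w'0; rewrite !size_map.
Qed.

(** The group embeds in the one-relator group on the natural numbers, where the
    numbers that do not number a letter are free generators; a left inverse
    sends them to 1. *)
Lemma word_problem_numbered (I : Type) (num : I -> nat) (a : I -> A) :
  injective num -> bijective a ->
  word_problem_decidable num (fun i => one_relator_gen r (a i)).
Proof.
move=> num_inj [g aK gK].
have rr' : square_reduced (word_map (num \o g) r).
  apply: (@square_reduced_map {classic A} nat); last exact: cyclically_reduced_square.
  by move=> c d _ _; apply: (inj_comp num_inj (can_inj gK)).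
pose r' := FreeGroup (reduced_catl rr').
have r'N1 : r' <> 1.
  move=> /(congr1 (fun x : free_group nat => size (x : word nat))).
  rewrite /= size_map => /size0nil r0; apply: r_neq1; exact: val_inj.
have [d [F rF FE] dP] := @word_problem_computable nat enc_nat r' rr' r'N1.
have wE w : (word_val (fun i => one_relator_gen r (a i)) w == 1) =
    d (word_map num w).
  apply/eqP/idP => [w1|/dP w1].
    apply/dP.
    have -> : word_map num w = word_map (num \o g) (word_map a w).
      rewrite /word_map -map_comp; apply: eq_map => -[i e] /=.
      by rewrite aK.
    apply: pw_map_eq1 => //.
    by rewrite -one_relator_val word_val_map.
  pose gen (k : nat) : one_relator_group r :=
    if pselect (exists i, num i = k) is left h then
      one_relator_gen r (a (projT1 (cid h))) else 1.
  have genE i : gen (num i) = one_relator_gen r (a i).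
    rewrite /gen; case: pselect => [h|[]]; last by exists i.
    by case: cid => j /= /num_inj ->.
  have genr s : [set r'] s -> word_val gen (s : free_group nat) = 1.
    move=> ->; rewrite /r' /= word_val_map (_ : gen \o _ = one_relator_gen r).
      by rewrite one_relator_val pw_rel //= fgw_id.
    by apply/funext => c; rewrite /= genE gK.
  have := pw_lift genr (etrans w1 (esym (pw_nil _))).
  rewrite word_val_nil word_val_map => <-; congr word_val.
  by apply/funext => i; rewrite /= genE.
have [C rC CE] : computable (fun s : seq nat => [seq (c./2, odd c) | c <- s]).
  apply: (comp_map (g := fun _ c => (c./2, odd c))); last exact: comp_id.
  have cs : computable (fun p : seq nat * nat => p.2) by exact: comp_snd comp_id.
  apply: comp_pair.
    apply: (comp_comp (f := half)) => //.
    by exists half => //; apply: rec1_half.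
  apply: (comp_comp (f := odd)) => //.
  by exists (fun n => nat_of_bool (odd n)) => //; apply: rec1_odd.
exists (fun v => F (C (thead v))); first exact: rec1_comp rF rC.
move=> w; rewrite wE /thead (tnth_nth 0) /=.
pose s := [seq ((num x.1).*2 + nat_of_bool x.2)%N | x <- w].
have -> : word_code num w = enc s by rewrite /word_code /= /enc_list map_id.
rewrite CE (_ : map _ s = word_map num w) ?FE //.
rewrite /s -map_comp; apply: eq_map => -[i e] /=.
by congr pair; case: e; rewrite ?addn1 ?addn0 /= ?uphalf_double ?doubleK ?odd_double.
Qed.

End GeneralAlphabet.

Theorem mainTheorem1 (A : Type) (r : free_group A)
    (r_neq1 : r <> 1) (r_cyc : cyclically_reduced r) :
  (forall A0 : set A, ~ (letters r `<=` A0) ->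
     injective
       (free_lift (fun a : set_type A0 => one_relator_gen r (sval a)))) /\
  ((forall (n : nat) (a : 'I_n -> A), bijective a ->
      word_problem_decidable (@nat_of_ord n)
        (fun i => one_relator_gen r (a i))) /\
   (forall a : nat -> A, bijective a ->
      word_problem_decidable id (fun i => one_relator_gen r (a i)))).
Proof.
split; first exact: freiheitssatz_set.
by split=> [n a bija|a bija]; apply: word_problem_numbered => //; apply: val_inj.
Qed.
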